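(* Let $s_1$ and $s_2$ be positive real numbers and let $\mathscr H_{\kappa}$ denote the module tensor product $L^2_a(\mathbb D, w_{s_1}) \otimes_{\mathbb C[z]} L^2_a(\mathbb D, w_{s_2})$ of the weighted Bergman Hilbert modules $L^2_a(\mathbb D, w_{s_1})$ and $L^2_a(\mathbb D, w_{s_2})$. Then there is a polynomial $p$ of degree $3$ such that $1/\|z^n\|^{2}_{\mathscr H_{\kappa}} = p(n)$ for all $n \in \mathbb N$. If $\tilde p$ denotes the analytic extension of $p$ to the complex plane (i.e. $p$ regarded as a polynomial function on $\mathbb C$), then the following hold: (1) If all roots of $\tilde p$ are real, then $\mathscr H_{\kappa}$ is a subnormal Hilbert module if and only if all roots of $\tilde p$ lie in $\mathbb L_0$. (2) If $\tilde p$ has a non-real complex root $z_0$, then $\mathscr H_{\kappa}$ is a subnormal Hilbert module if and only if $z_0$ lies in the closure of $\mathbb L_{-1}$. Here, for a real number $r$, $\mathbb L_r := \{z \in \mathbb C : \operatorname{Re} z < r\}$.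
   Context: $\mathbb N=\{0,1,2,\dots\}$ and $\mathbb D$ is the open unit disc in $\mathbb C$. Let $\mathscr H$ be a reproducing kernel Hilbert space of holomorphic functions on $\mathbb D$ such that $zf\in\mathscr H$ whenever $f\in\mathscr H$. Then the operator $\mathscr M_z$ of multiplication by the coordinate function $z$ is bounded on $\mathscr H$, and $\mathscr H$ is a Hilbert module over $\mathbb C[z]$ with action $(p,f)\mapsto p(\mathscr M_z)f = pf$. The Hilbert module $\mathscr H$ is called subnormal if $\mathscr M_z$ is a subnormal operator, i.e. $\mathscr M_z$ has a normal extension on some Hilbert space containing $\mathscr H$. For $s>0$, $L^2_a(\mathbb D, w_s)$ is the Hilbert space of holomorphic functions on $\mathbb D$ that are square integrable with respect to $w_s\,dA$ ($dA$ is area measure), where $w_s(z)=\frac{1}{s\pi}|z|^{\frac{2(1-s)}{s}}$. The monomials $z^n$ are orthogonal in it with $\|z^n\|^2=\frac{1}{sn+1}$ $(n\in\mathbb N)$, and it is the reproducing kernel Hilbert space with kernel $\kappa_s(z,w)=\frac{s}{(1-z\overline w)^2}+\frac{1-s}{1-z\overline w}$. Module tensor product: for Hilbert $\mathbb C[z]$-modules $\mathscr H,\mathscr K$, $\mathscr H\otimes_{\mathbb C[z]}\mathscr K$ is obtained from the Hilbert space tensor product by dividing out the natural action of $\mathbb C[z]$ on the two factors. By a result of Salinas, $\mathscr H_{\kappa_1}\otimes_{\mathbb C[z]}\mathscr H_{\kappa_2}$ is $\mathbb C[z]$-isomorphic to the reproducing kernel Hilbert space $\mathscr H_{\kappa_1\kappa_2}$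 with kernel $\kappa_1\kappa_2$ (for diagonal kernels as here), and it is identified with $\mathscr H_{\kappa_1\kappa_2}$ throughout. Thus $\mathscr H_\kappa$ is the reproducing kernel Hilbert space on $\mathbb D$ with kernel $\kappa=\kappa_{s_1}\kappa_{s_2}$; its monomials are orthogonal and $$\|z^n\|^2_{\mathscr H_{\kappa_1\kappa_2}} = \Big(\sum_{k=0}^n \frac{1}{\|z^k\|^2_{\mathscr H_{\kappa_1}}}\frac{1}{\|z^{n-k}\|^2_{\mathscr H_{\kappa_2}}}\Big)^{-1}\quad(n\in\mathbb N).$$ *)

(* Defs.v *)
From HB Require Import structures.
From mathcomp Require Import all_boot all_order all_algebra complex.
From mathcomp Require Import all_classical all_reals all_analysis.
Import numFieldNormedType.Exports.
Import Order.TTheory GRing.Theory Num.Theory.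

Set Implicit Arguments.
Unset Strict Implicit.
Unset Printing Implicit Defensive.

Local Open Scope classical_set_scope.
Local Open Scope ring_scope.

(* The dot product is linear in its first argument and conjugate-linear in
   the second; norms of vectors are R[i]-valued, as R[i] is the scalar field. *)
Record hilbert (R : realType) := Hilbert {
  hilbert_sort :> completeNormedModType R[i];
  hdot : {dot hilbert_sort for @Num.conj R[i]};
  hdot_norm : forall x : hilbert_sort, `|x| ^+ 2 = hdot x x }.

Definition is_adjoint (R : realType) (H : hilbert R) (N M : H -> H) :=
  forall x y : H, hdot H (N x) y = hdot H x (M y).

Definition normal_op (R : realType) (H : hilbert R) (N : {linear H -> H}) :=
  continuous N /\
  exists M : {linear H -> H},
    is_adjoint N M /\ forall x, N (M x) = M (N x).

(* The inclusion of H into the larger space K is an isometric embedding J. *)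
Definition subnormal_op (R : realType) (H : hilbert R)
    (T : {linear H -> H}) :=
  exists (K : hilbert R) (J : {linear H -> K}) (N : {linear K -> K}),
    [/\ forall x y, hdot K (J x) (J y) = hdot H x y,
        normal_op N
      & forall x, N (J x) = J (T x)].

Definition disc (R : realType) := {z : R[i] | `|z| < 1}.

(* A Hilbert space of functions X -> R[i] with reproducing kernel k: the
   vector f is the function rk_eval f, and rk_point w is k(., w). Linearity of
   rk_eval follows from rk_reproducing. For each k there is at most one such
   space, up to a unique unitary commuting with rk_eval. *)
Record rkhs (R : realType) (X : Type) (k : X -> X -> R[i]) := Rkhs {
  rkhs_sort :> hilbert R;
  rk_eval : rkhs_sort -> X -> R[i];
  rk_eval_inj : injective rk_eval;
  rk_point : X -> rkhs_sort;
  rk_pointE : forall z w, rk_eval (rk_point w) z = k z w;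
  rk_reproducing : forall f w, rk_eval f w = hdot rkhs_sort f (rk_point w) }.

(* The reproducing kernel of the weighted Bergman space L^2_a(D, w_s),
   w_s(z) = |z|^(2(1-s)/s) / (s pi). *)
Definition bergman_kernel (R : realType) (s : R) (z w : disc R) : R[i] :=
  let t := 1 - \val z * (\val w)^* in
  (real_complex R s) / t ^+ 2 + (real_complex R (1 - s)) / t.

(* By Salinas, the tensor product over C[z] of the Hilbert modules with
   (diagonal) kernels k1 and k2 is the one with kernel k1 k2. *)
Definition module_tensor (R : realType) (k1 k2 : disc R -> disc R -> R[i]) :=
  rkhs (fun z w => k1 z w * k2 z w).

Definition is_mulz (R : realType) (k : disc R -> disc R -> R[i]) (H : rkhs k)
    (T : H -> H) :=
  forall (f : H) (z : disc R), rk_eval (T f) z = \val z * rk_eval f z.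

Definition subnormal_module (R : realType) (k : disc R -> disc R -> R[i])
    (H : rkhs k) :=
  exists T : {linear H -> H}, is_mulz T /\ subnormal_op T.

Definition is_monomial (R : realType) (k : disc R -> disc R -> R[i])
    (H : rkhs k) (n : nat) (f : H) :=
  forall z : disc R, rk_eval f z = (\val z) ^+ n.

(* R[i]^o is R[i] with the topology of its norm. *)
Definition left_half_plane (R : realType) (r : R) : set R[i]^o :=
  [set z : R[i] | complex.Re z < r].

(* Main.v *)
(* Here 1/|z^n|^2 = p(n) for a cubic p = (a/6) (X+1) (X^2 + b X + g), and M_z is
   the weighted shift with moments 1/p(n).

   If M_z is subnormal, a normal extension N and g = z^k give
   <(1 - N^*N)^n g, g> >= 0, i.e. the alternating n-th differences of 1/p are
   nonnegative (boundedness of |N^j g| yields this for odd n). When p has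
   positive real roots, or non-real roots of real part > -1, these differences
   are combinations of the products n! / prod_(j <= n) (j - r), r a root of p,
   whose growth or oscillation makes some of them negative.

   Conversely, a normal extension exists as soon as the kernel
   G((i,j),(k,l)) = [i+l = k+j] / p(i+l), the Gram matrix of z^i zbar^j, is
   positive semidefinite. It is built on H itself: H has an orthonormal basis,
   so a Cholesky decomposition realizes G by vectors of H, on which (i,j) ->
   (i+1,j) and (i,j) -> (i,j+1) act as contractions adjoint to each other.
   Positivity of G follows from Cauchy kernels 1/(x_i + conj x_j): directly
   when the roots are negative, and for roots x +- iy with x <= -1 from
   1/((t+1) q(t)) = (1 + |x+1|/(t+1)) / ((t-x) q(t)), q(t) = (t-x)^2 + y^2,
   where 1/((t-x) q(t)) is the transform of e^(xu) |1 - e^(iyu)|^2 / (2y^2). *)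
Require Import Defs.
From HB Require Import structures.
From mathcomp Require Import all_boot all_order all_algebra complex ring lra zify.
From mathcomp Require Import all_classical all_reals all_analysis.
Import numFieldNormedType.Exports.
Import Order.TTheory GRing.Theory Num.Theory.

Set Implicit Arguments.
Unset Strict Implicit.
Unset Printing Implicit Defensive.

Local Open Scope classical_set_scope.
Local Open Scope ring_scope.

(** [H] is an arbitrary realization of the kernel, so even its monomials have to be produced:
    removing from [rk_point w] its components along 1, ..., z^(n-1), dividing by conj(w)^n and
    letting w tend to 0 leaves a multiple of z^n. Remainders of the kernel are kept in closed form,
    which avoids power series in [H]. Shifts are at first only maps on the indices of a Gram matrix.
    One principle serves both directions: for a normal operator the numbers |N^k u|^2 are log-convex
    in k, and a bounded log-convex sequence cannot increase at its first step. Two inequalities on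
    the quadratic factor settle the borderline cases: g > 0 excludes the root 0, and b > -1 makes
    the sum of its roots less than 1. So positive real roots lie in (0, 1), and non-real roots r
    have real part below 1/2; after at most one shift of the moments, -r has positive real part
    whenever Re r > -1. *)

Local Notation toC := (real_complex _).

(** * Hilbert spaces and contractions *)

Section Hilbert.
Variables (R : realType) (H : hilbert R).
Implicit Types (x y z : H) (a : R[i]).
Local Notation dot := (hdot H).

Lemma dotDl x y z : dot (x + y) z = dot x z + dot y z.
Proof. exact: linearDl. Qed.

Lemma dotDr x y z : dot z (x + y) = dot z x + dot z y.
Proof. exact: linearDr. Qed.

Lemma dotBl x y z : dot (x - y) z = dot x z - dot y z.
Proof. exact: linearBl. Qed.

Lemma dotBr x y z : dot z (x - y) = dot z x - dot z y.
Proof. exact: linearBr. Qed.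

Lemma dot0l x : dot 0 x = 0.
Proof. exact: linear0l. Qed.

Lemma dot0r x : dot x 0 = 0.
Proof. exact: linear0r. Qed.

Lemma dotZl a x y : dot (a *: x) y = a * dot x y.
Proof. by rewrite linearZl_LR. Qed.

Lemma dotZr a x y : dot x (a *: y) = a^* * dot x y.
Proof. by rewrite linearZr_LR. Qed.

Lemma dotC x y : dot x y = (dot y x)^*.
Proof. by have := hermC (hdot H) x y; rewrite mul1r. Qed.

Lemma dot_suml (I : Type) (r : seq I) (P : pred I) (F : I -> H) y :
  dot (\sum_(i <- r | P i) F i) y = \sum_(i <- r | P i) dot (F i) y.
Proof.
by elim/big_rec2: _ => [|i u v _ <-]; [exact: dot0l|rewrite dotDl].
Qed.

Lemma dot_sumr (I : Type) (r : seq I) (P : pred I) (F : I -> H) y :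
  dot y (\sum_(i <- r | P i) F i) = \sum_(i <- r | P i) dot y (F i).
Proof.
by elim/big_rec2: _ => [|i u v _ <-]; [exact: dot0r|rewrite dotDr].
Qed.

Definition nsq x : R := complex.Re (dot x x).

Lemma nsqE x : dot x x = toC (nsq x).
Proof. by rewrite RRe_real// ger0_real// dnorm_ge0. Qed.

Lemma nsq_ge0 x : 0 <= nsq x.
Proof. by rewrite -ler0c -nsqE dnorm_ge0. Qed.

Lemma nsq_norm x : toC (nsq x) = `|x| ^+ 2.
Proof. by rewrite hdot_norm nsqE. Qed.

Lemma nsq_eq0 x : nsq x = 0 -> x = 0.
Proof. by move=> x0; apply/eqP; rewrite -(dnorm_eq0 (hdot H)) nsqE x0. Qed.

Lemma nsq0 : nsq 0 = 0.
Proof. by rewrite /nsq dot0l. Qed.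

Lemma nsqZ a x : toC (nsq (a *: x)) = `|a| ^+ 2 * toC (nsq x).
Proof. by rewrite -!nsqE dotZl dotZr normCK mulrA. Qed.

Lemma conj_toC (r : R) : (toC r)^* = toC r.
Proof. exact: conjc_real. Qed.

Lemma nsqZr (r : R) x : nsq (toC r *: x) = r ^+ 2 * nsq x.
Proof.
apply: (@complexI R); rewrite nsqZ rmorphM rmorphXn /=; congr (_ * _).
by rewrite normCK conj_toC expr2.
Qed.

Lemma nsqN x : nsq (- x) = nsq x.
Proof. by rewrite /nsq -{1 2}scaleN1r dotZl dotZr rmorphN1 mulrA mulrNN !mul1r. Qed.

Lemma nsqC x y : nsq (x - y) = nsq (y - x).
Proof. by rewrite -nsqN opprB. Qed.

Lemma ReD (a b : R[i]) : complex.Re (a + b) = complex.Re a + complex.Re b.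
Proof. by case: a b => [? ?] [? ?]. Qed.

Lemma ReN (a : R[i]) : complex.Re (- a) = - complex.Re a.
Proof. by case: a. Qed.

Lemma Re_conj (a : R[i]) : complex.Re a^* = complex.Re a.
Proof. by case: a. Qed.

Lemma Re_toCM (r : R) (a : R[i]) : complex.Re (toC r * a) = r * complex.Re a.
Proof. by case: a => u v /=; rewrite mul0r subr0. Qed.

Lemma nsqD x y : nsq (x + y) = nsq x + nsq y + 2 * complex.Re (dot x y).
Proof.
rewrite /nsq dotDl !dotDr !ReD [dot y x]dotC Re_conj.
by rewrite mulr_natl mulr2n; ring.
Qed.

Lemma nsqB x y : nsq (x - y) = nsq x + nsq y - 2 * complex.Re (dot x y).
Proof. by rewrite nsqD nsqN -sub0r dotBr dot0r sub0r ReN mulrN. Qed.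

Lemma nsqD_le x y : nsq (x + y) <= 2 * nsq x + 2 * nsq y.
Proof. by have := nsq_ge0 (x - y); rewrite nsqB nsqD; lra. Qed.

Lemma nsqB_le x y : nsq (x - y) <= 2 * nsq x + 2 * nsq y.
Proof. by rewrite -[nsq y]nsqN nsqD_le. Qed.

Lemma nsqD_orth x y : dot x y = 0 -> nsq (x + y) = nsq x + nsq y.
Proof. by rewrite nsqD => ->; rewrite mulr0 addr0. Qed.

Lemma normc_sq (a : R[i]) :
  `|a| ^+ 2 = toC (complex.Re a ^+ 2 + complex.Im a ^+ 2).
Proof. by rewrite add_Re2_Im2. Qed.

Lemma Re_sq_le_norm (a : R[i]) (r : R) :
  `|a| ^+ 2 <= toC r -> complex.Re a ^+ 2 <= r.
Proof. by rewrite normc_sq lecR; have := sqr_ge0 (complex.Im a); lra. Qed.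

Lemma CS x y : `|dot x y| ^+ 2 <= toC (nsq x * nsq y).
Proof.
have [->|y0] := eqVneq y 0; first by rewrite dot0r normr0 expr0n lecR nsq0 mulr0.
have yy : 0 < nsq y.
  rewrite lt_def nsq_ge0 andbT; apply: contra y0 => /eqP/nsq_eq0->//.
set c := dot x y; set m := complex.Re c ^+ 2 + complex.Im c ^+ 2.
have cm : `|c| ^+ 2 = toC m by rewrite normc_sq.
have := nsq_ge0 (toC (nsq y) *: x - c *: y).
rewrite nsqB nsqZr dotZl dotZr Re_toCM -/c [c^* * c]mulrC -normCK cm /=.
have -> : nsq (c *: y) = m * nsq y.
  by apply: (@complexI R); rewrite nsqZ cm -rmorphM.
by rewrite lecR => h; rewrite -(ler_pM2l yy); lra.
Qed.

Lemma CS_Re x y : complex.Re (dot x y) ^+ 2 <= nsq x * nsq y.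
Proof. exact/Re_sq_le_norm/CS. Qed.

(** Convergence through the real-valued [nsq]; [hcomplete] translates from the filters of the
    R[i]-valued norm. *)
Definition hcvg (u : nat -> H) x :=
  forall e : R, 0 < e -> exists N, forall n, (N <= n)%N -> nsq (u n - x) < e.

Lemma hcomplete (u : nat -> H) :
  (forall e : R, 0 < e -> exists N, forall m n,
    (N <= m)%N -> (N <= n)%N -> nsq (u m - u n) < e) ->
  exists x, hcvg u x.
Proof.
move=> hu.
have /cauchy_cvgP/cvg_ex[x /cvgrPdist_lt ux] : cauchy (u @ \oo).
  apply/cauchy_exP => e e0.
  have ee : e = toC (complex.Re e) by rewrite RRe_real// gtr0_real.
  have re : 0 < complex.Re e by move: e0; rewrite ee ltcR.
  have [N hN] := hu _ (exprn_gt0 2 re).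
  exists (u N); exists N => // n /= Nn.
  rewrite -ball_normE /= ee -(ltr_pXn2r (n := 2)) ?nnegrE ?normr_ge0 ?ler0c ?ltW//.
  by rewrite -nsq_norm -rmorphXn ltcR hN.
exists x => e e0.
have se : 0 < Num.sqrt e by rewrite sqrtr_gt0.
have [|N _ hN] := ux (toC (Num.sqrt e)); first by rewrite ltcR.
exists N => n /hN /=.
rewrite -(ltr_pXn2r (n := 2)) ?nnegrE ?normr_ge0 ?ler0c ?ltW//.
by rewrite -nsq_norm -rmorphXn ltcR /= sqr_sqrtr ?ltW// nsqC.
Qed.

End Hilbert.

Lemma contraction_continuous (R : realType) (H K : hilbert R)
    (L : {linear H -> K}) :
  (forall x, nsq (L x) <= nsq x) -> continuous L.
Proof.
move=> Lle; apply: bounded_linear_continuous; apply/linear_boundedP.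
exists 1; split => // r r1 x.
have r0 : 0 <= r by rewrite ltW// (lt_trans ltr01).
rewrite (@le_trans _ _ `|x|)//; last first.
  by rewrite ler_peMl// ltW.
rewrite -(ler_pXn2r (n := 2)) ?nnegrE ?normr_ge0//.
by rewrite -!nsq_norm lecR.
Qed.

Lemma inv_nat_small (R : realType) (e : R) : 0 < e ->
  exists N, forall n, (N <= n)%N -> n.+1%:R^-1 < e.
Proof.
move=> e0; exists (Num.truncn e^-1) => n Nn.
rewrite invf_plt ?posrE// (lt_le_trans (truncnS_gt _))//.
by rewrite ler_nat.
Qed.

Lemma nsq_near (R : realType) (H : hilbert R) (x : H) (e : R) : 0 < e ->
  exists2 d : R, 0 < d &
    forall y, nsq (x - y) < d -> nsq y <= nsq x + e /\ nsq x <= nsq y + e.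
Proof.
move=> e0; set c := nsq x; have c0 : 0 <= c by exact: nsq_ge0.
(* This [d] satisfies both d <= e/4 and c d <= (e/4)^2, so the cross term 2 Re <x, u> is at most e/2
   in modulus. *)
pose d := e ^+ 2 / (16 * (c + 1) + 4 * e).
have k0 : 0 < 16 * (c + 1) + 4 * e by lra.
have d0 : 0 < d by rewrite divr_gt0// exprn_gt0.
have de : d * (16 * (c + 1) + 4 * e) = e ^+ 2 by rewrite divfK// gt_eqF.
exists d => // y.
have -> : nsq y = nsq (x - (x - y)) by rewrite subKr.
set u := x - y => ud; rewrite nsqB -/c.
have hcs := CS_Re x u; set t := complex.Re _ in hcs *.
have u0 := nsq_ge0 u.
have d2 : d <= e / 4 by rewrite ler_pdivrMr// ; nra.
have t2 : t ^+ 2 <= (e / 4) ^+ 2.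
  apply: le_trans hcs _; apply: (@le_trans _ _ (c * d)).
    by apply: ler_wpM2l => //; exact: ltW.
  have : 0 <= d * e by rewrite mulr_ge0 ?ltW//.
  lra.
have : `|t| <= e / 4.
  rewrite -(ler_pXn2r (n := 2)) ?nnegrE ?real_normK ?num_real//; lra.
rewrite ler_norml => /andP[t3 t4]; split; lra.
Qed.

(** * Extension of contractions from dense families *)

Section Extension.
Variables (R : realType) (I : Type).
Local Notation C := R[i].

(** Formal combinations are lists in which an index may occur several times: addition is
    concatenation, and [I] needs no decidable equality. *)
Definition comb (H : hilbert R) (x : I -> H) (s : seq (C * I)) : H :=
  \sum_(t <- s) t.1 *: x t.2.

Definition dense (H : hilbert R) (x : I -> H) :=
  forall (f : H) (e : R), 0 < e -> exists s, nsq (f - comb x s) < e.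

Definition scale_comb (a : C) (s : seq (C * I)) := [seq (a * t.1, t.2) | t <- s].

Lemma comb_cat (H : hilbert R) (x : I -> H) s1 s2 :
  comb x (s1 ++ s2) = comb x s1 + comb x s2.
Proof. by rewrite /comb big_cat. Qed.

Lemma comb_scale (H : hilbert R) (x : I -> H) a s :
  comb x (scale_comb a s) = a *: comb x s.
Proof.
by rewrite /comb big_map scaler_sumr; apply: eq_bigr => t _; rewrite scalerA.
Qed.

Lemma comb1 (H : hilbert R) (x : I -> H) a i : comb x [:: (a, i)] = a *: x i.
Proof. by rewrite /comb big_seq1. Qed.

Variables (H K : hilbert R) (x : I -> H) (y : I -> K).
Hypothesis comb_le : forall s, nsq (comb y s) <= nsq (comb x s).
Hypothesis x_dense : dense x.

(** The closure of the set of pairs [(comb x s, comb y s)]. As the family [x] may be linearly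
    dependent, the operator is defined by this relation; that it is single-valued follows from
    [graph_lin] and [graph_le]. *)
Let graph f g := forall e : R, 0 < e ->
  exists s, nsq (f - comb x s) < e /\ nsq (g - comb y s) < e.

Let graph_total f : exists g, graph f g.
Proof.
have pos n : 0 < n.+1%:R^-1 :> R by rewrite invr_gt0.
have /choice[s hs] : forall n, exists s, nsq (f - comb x s) < n.+1%:R^-1.
  by move=> n; exact: x_dense.
have [e e0|g hg] := @hcomplete R K (fun n => comb y (s n)).
  have [N hN] := inv_nat_small (divr_gt0 e0 (ltr0Sn _ 3)).
  exists N => m n Nm Nn.
  have <- : comb y (s m ++ scale_comb (-1) (s n)) = comb y (s m) - comb y (s n).
    by rewrite comb_cat comb_scale scaleN1r.
  apply: le_lt_trans (comb_le _) _.
  rewrite comb_cat comb_scale scaleN1r.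
  have -> : comb x (s m) - comb x (s n)
      = (f - comb x (s n)) - (f - comb x (s m)).
    by rewrite [RHS]addrC opprB addrA subrK.
  apply: le_lt_trans (nsqB_le _ _) _.
  move: (hN m Nm) (hN n Nn) (hs n) (hs m).
  move: m.+1%:R^-1 n.+1%:R^-1 (nsq _) (nsq _) => u v p q; lra.
exists g => e e0.
have [N hN] := inv_nat_small e0; have [M hM] := hg e e0.
exists (s (maxn N M)); split.
  by rewrite (lt_trans (hs _))// hN// leq_maxl.
by rewrite nsqC hM// leq_maxr.
Qed.

Let graph_lin a f g f' g' :
  graph f g -> graph f' g' -> graph (a *: f + f') (a *: g + g').
Proof.
move=> hf hf' e e0.
pose k := complex.Re a ^+ 2 + complex.Im a ^+ 2.
have k0 : 0 <= k by rewrite addr_ge0 ?sqr_ge0.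
have nk (V : hilbert R) (v : V) : nsq (a *: v) = k * nsq v.
  by apply: (@complexI R); rewrite nsqZ normc_sq rmorphM.
pose d := e / (4 * (k + 1)).
have d0 : 0 < d by rewrite divr_gt0// ; lra.
have de : d * (4 * (k + 1)) = e by rewrite divfK//; lra.
have [s [s1 s2]] := hf d d0; have [s' [s1' s2']] := hf' d d0.
have bound (V : hilbert R) (u v u' v' : V) : nsq (u - v) < d ->
    nsq (u' - v') < d -> nsq (a *: u + u' - (a *: v + v')) < e.
  move=> h1 h2; rewrite opprD addrACA -scalerBr.
  apply: le_lt_trans (nsqD_le _ _) _; rewrite nk.
  have := nsq_ge0 (u - v).
  by move: h1 h2; move: (nsq _) (nsq _) => p q; nra.
exists (scale_comb a s ++ s'); rewrite !comb_cat !comb_scale.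
by split; exact: bound.
Qed.

Let graph_le f g : graph f g -> nsq g <= nsq f.
Proof.
move=> hfg; apply/ler_addgt0Pr => e e0.
have e2 : 0 < e / 2 by lra.
have [d1 d10 h1] := nsq_near f e2; have [d2 d20 h2] := nsq_near g e2.
have [|s [s1 s2]] := hfg (Num.min d1 d2); first by rewrite lt_min d10.
move: s1 s2; rewrite !lt_min => /andP[/h1[+ _] _] /andP[_ /h2[_]].
have := comb_le s; lra.
Qed.

Lemma contraction_extension : exists L : {linear H -> K},
  (forall i, L (x i) = y i) /\ (forall f, nsq (L f) <= nsq f).
Proof.
have /choice[L hL] := graph_total.
have uniq f g g' : graph f g -> graph f g' -> g = g'.
  move=> h h'; have := graph_lin (-1) h h'; rewrite !scaleN1r addNr.
  move=> /graph_le; rewrite nsq0 => le0.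
  have /nsq_eq0/eqP : nsq (- g + g') = 0 by apply/eqP; rewrite eq_le le0 nsq_ge0.
  by rewrite addrC subr_eq0 => /eqP.
have Llin : linear L.
  move=> a f f'; apply: uniq (hL _) _; exact: graph_lin.
pose L' : {linear H -> K} := HB.pack L (GRing.isLinear.Build _ _ _ _ L Llin).
exists L'; split => [i|f]; last exact: graph_le.
apply: uniq (hL _) _ => e e0; exists [:: (1, i)].
by rewrite !comb1 !scale1r !subrr !nsq0.
Qed.

(** Serves to check operator identities on generators. [phi] is a bare function, so that an
    expression such as [hdot H (N (M u) - M (N u)) w] fits without being packed as a linear map. *)
Lemma dense_functional_eq0 (phi : H -> C) (c : R) :
  (forall a f g, phi (a *: f + g) = a * phi f + phi g) ->
  (forall f, `|phi f| ^+ 2 <= real_complex R (c * nsq f)) ->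
  (forall i, phi (x i) = 0) -> forall f, phi f = 0.
Proof.
move=> lin bd x0 f.
have phi0 : phi 0 = 0.
  have /(congr1 (fun u => u - phi 0)) := lin 1 0 0.
  by rewrite scale1r addr0 mul1r subrr addrK.
have comb0 s : phi (comb x s) = 0.
  elim: s => [|t s IH]; first by rewrite /comb big_nil.
  by rewrite /comb big_cons lin x0 IH mulr0 addr0.
have phifE s : phi f = phi (f - comb x s).
  have := lin (-1) (comb x s) f.
  by rewrite comb0 mulr0 add0r scaleN1r addrC => ->.
pose m := complex.Re (phi f) ^+ 2 + complex.Im (phi f) ^+ 2.
have mE : `|phi f| ^+ 2 = real_complex R m by rewrite normc_sq.
suff : m <= 0.
  move=> m0; apply/eqP; rewrite -normr_eq0 -sqrf_eq0 mE eq_le ler0c lecR m0.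
  by rewrite andTb addr_ge0 ?sqr_ge0.
apply/ler_addgt0Pr => e e0; rewrite add0r.
have [d d0 dc] : exists2 d, 0 < d & d * (`|c| + 1) = e.
  have k0 : 0 < `|c| + 1 by have := normr_ge0 c; lra.
  by exists (e / (`|c| + 1)); [rewrite divr_gt0|rewrite divfK// gt_eqF].
have [s hs] := x_dense f d0.
have := bd (f - comb x s); rewrite -phifE mE lecR => /le_trans; apply.
have k0 := normr_ge0 c; have n0 := nsq_ge0 (f - comb x s).
apply: (@le_trans _ _ (`|c| * nsq (f - comb x s))).
  by rewrite ler_wpM2r// ler_norm.
apply: (@le_trans _ _ (`|c| * d)); first by rewrite ler_wpM2l// ltW.
by rewrite -dc mulrC ler_pM2l// lerDl.
Qed.

End Extension.

(** * Positive semidefinite kernels *)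

Section PositiveKernel.
Variable R : realType.
Local Notation C := R[i].

Definition kform (I : Type) (G : I -> I -> C) (s : seq (C * I)) : C :=
  \sum_(a <- s) \sum_(b <- s) a.1 * b.1^* * G a.2 b.2.

Definition psd (I : Type) (G : I -> I -> C) :=
  (forall i j, G i j = (G j i)^*) /\ forall s, 0 <= kform G s.

Lemma kform_cons (I : Type) (G : I -> I -> C) x k s :
  kform G ((x, k) :: s) = x * x^* * G k k +
    x * \sum_(b <- s) b.1^* * G k b.2 +
    x^* * \sum_(a <- s) a.1 * G a.2 k + kform G s.
Proof.
rewrite /kform big_cons big_cons /= -!addrA; congr (_ + (_ + _)).
  by rewrite mulr_sumr; apply: eq_bigr => b _; rewrite mulrA.
under eq_bigr do rewrite big_cons /=.
rewrite big_split; congr (_ + _); rewrite mulr_sumr.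
by apply: eq_bigr => a _; rewrite mulrA [x^* * _]mulrC.
Qed.

Lemma nsq_comb (H : hilbert R) (I : Type) (x : I -> H) s :
  real_complex R (nsq (comb x s)) = kform (fun i j => hdot H (x i) (x j)) s.
Proof.
rewrite -nsqE /comb dot_suml; apply: eq_bigr => a _.
rewrite dot_sumr; apply: eq_bigr => b _.
by rewrite dotZl dotZr mulrA.
Qed.

Lemma eq_kform (I : Type) (G G' : I -> I -> C) s :
  (forall i j, G i j = G' i j) -> kform G s = kform G' s.
Proof.
by move=> GG; apply: eq_bigr => a _; apply: eq_bigr => b _; rewrite GG.
Qed.

Lemma kform_map (I J : Type) (G : I -> I -> C) (f : J -> I) s :
  kform G [seq (t.1, f t.2) | t <- s] = kform (fun i j => G (f i) (f j)) s.
Proof.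
by rewrite /kform big_map; apply: eq_bigr => a _; rewrite big_map.
Qed.

Lemma psd_comp (I J : Type) (G : I -> I -> C) (f : J -> I) :
  psd G -> psd (fun i j => G (f i) (f j)).
Proof. by move=> [hG pG]; split => [i j|s]; [exact: hG|rewrite -kform_map]. Qed.

Lemma eq_psd (I : Type) (G G' : I -> I -> C) :
  (forall i j, G i j = G' i j) -> psd G -> psd G'.
Proof.
move=> GG [hG pG]; split => [i j|s]; first by rewrite -!GG.
by rewrite -(eq_kform _ GG).
Qed.

Lemma psd_diag (I : Type) (G : I -> I -> C) i : psd G -> 0 <= G i i.
Proof.
move=> [_ /(_ [:: (1, i)])].
by rewrite /kform !big_seq1 conjC1 !mul1r.
Qed.

(** With coefficients -r conj(g) at [i] and 1 at [j], where g = G i j, positivity of the form reads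
    2 r |g|^2 <= G j j for every real r, which forces g = 0. *)
Lemma psd_diag0 (I : Type) (G : I -> I -> C) i j : psd G ->
  G i i = 0 -> G i j = 0.
Proof.
move=> pG Gii; have [hG fG] := pG.
have Gjj := psd_diag j pG.
set g := G i j.
have h (r : R) : 2 * r * (complex.Re g ^+ 2 + complex.Im g ^+ 2)
    <= complex.Re (G j j).
  have := fG [:: (- (real_complex R r) * g^*, i); (1, j)].
  rewrite kform_cons /kform !big_seq1 /= Gii mulr0 add0r conjC1 !mul1r.
  rewrite [G j i]hG -/g rmorphM rmorphN /= conjCK conj_toC.
  have gg : g^* * g =
      real_complex R (complex.Re g ^+ 2 + complex.Im g ^+ 2).
    by rewrite mulrC -normCK normc_sq.
  rewrite -!mulrA [g * _]mulrC gg -rmorphN -rmorphM lecE => /andP[_].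
  rewrite !ReD /=; lra.
pose m := complex.Re g ^+ 2 + complex.Im g ^+ 2.
have m0 : 0 <= m by rewrite addr_ge0 ?sqr_ge0.
apply/eqP; rewrite -normr_eq0 -sqrf_eq0 normc_sq -/m.
suff -> : m = 0 by [].
apply/eqP; rewrite eq_le m0 andbT leNgt; apply/negP => mp.
have := h ((`|complex.Re (G j j)| + 1) / (2 * m)).
rewrite -/m; have -> : 2 * ((`|complex.Re (G j j)| + 1) / (2 * m)) * m =
  `|complex.Re (G j j)| + 1 by field; rewrite gt_eqF.
have := ler_norm (complex.Re (G j j)); lra.
Qed.

Definition schur (I : Type) (G : I -> I -> C) k i j :=
  G i j - G i k * G k j / G k k.

(** The value of the complement at [s] is that of [G] at [s] with the point [k] added, its
    coefficient -l / G k k being the one that minimizes the form. *)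
Lemma psd_schur (I : Type) (G : I -> I -> C) k : psd G -> psd (schur G k).
Proof.
move=> pG; have [hG fG] := pG.
have Gkk : (G k k)^* = G k k by rewrite -hG.
have [k0|k0] := eqVneq (G k k) 0.
  by apply: eq_psd pG => i j; rewrite /schur k0 invr0 mulr0 subr0.
split=> [i j|s].
  rewrite /schur rmorphB !rmorphM fmorphV /= Gkk -hG -[(G j k)^*]hG.
  by rewrite -[(G k i)^*]hG [G k j * _]mulrC.
set l := \sum_(a <- s) a.1 * G a.2 k.
have lc : \sum_(b <- s) b.1^* * G k b.2 = l^*.
  by rewrite rmorph_sum; apply: eq_bigr => b _; rewrite rmorphM /= -hG.
suff -> : kform (schur G k) s = kform G ((- (l / G k k), k) :: s) by [].
rewrite kform_cons lc -/l rmorphN rmorphM fmorphV /= Gkk.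
have -> : kform (schur G k) s = kform G s - l * l^* / G k k.
  rewrite -lc /l mulr_suml mulr_suml -sumrB; apply: eq_bigr => a _.
  rewrite mulr_sumr mulr_suml -sumrB; apply: eq_bigr => b _.
  by rewrite /schur; ring.
by field.
Qed.

Fixpoint schurn (G : nat -> nat -> C) n :=
  if n is m.+1 then schur (schurn G m) m else G.

(* If the k-th pivot is 0, positivity makes the whole k-th row of the k-th
   complement vanish, so the junk value x / 0 = 0 is the right one. *)
Definition chol G i k := schurn G k i k / sqrtC (schurn G k k k).

Variables (G : nat -> nat -> C) (pG : psd G).

Lemma psd_schurn n : psd (schurn G n).
Proof. by elim: n => //= n IH; exact: psd_schur. Qed.

Lemma schurn0 n i j : (i < n)%N -> schurn G n i j = 0.
Proof.
elim: n i j => // n IH i j; rewrite ltnS leq_eqVlt => /orP[/eqP->|lin] /=.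
  rewrite /schur; have [n0|n0] := eqVneq (schurn G n n n) 0.
    rewrite n0 invr0 mulr0 subr0; exact: psd_diag0 (psd_schurn n) n0.
  by rewrite mulrAC divff// mul1r subrr.
by rewrite /schur !(IH i _ lin) !mul0r subr0.
Qed.

Lemma chol_upper i k : (i < k)%N -> chol G i k = 0.
Proof. by move=> ik; rewrite /chol schurn0// mul0r. Qed.

(** The rank one kernel built from column [k] is exactly what the [k]-th Schur step removes, so that
    the sum over [k] telescopes. *)
Lemma chol_mul i j k :
  chol G i k * (chol G j k)^* = schurn G k i j - schurn G k.+1 i j.
Proof.
have p := psd_schurn k; have [hG _] := p.
have d0 := psd_diag k p.
rewrite /= /schur subKr /chol rmorphM fmorphV /= -hG.
rewrite [(sqrtC _)^*]conj_Creal ?ger0_real ?sqrtC_ge0//.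
by rewrite mulrACA -invfM -expr2 sqrtCK.
Qed.

Lemma chol_gram i j n : (i < n)%N ->
  \sum_(k < n) chol G i k * (chol G j k)^* = G i j.
Proof.
move=> lin; under eq_bigr do rewrite chol_mul.
have -> m : \sum_(k < m) (schurn G k i j - schurn G k.+1 i j) =
    G i j - schurn G m i j.
  elim: m => [|m IH]; first by rewrite big_ord0 subrr.
  by rewrite big_ord_recr IH /= addrA subrK.
by rewrite schurn0// subr0.
Qed.

Variables (H : hilbert R) (e : nat -> H).
Hypothesis e_orth : forall i j, hdot H (e i) (e j) = (i == j)%:R.

Let phi i : H := \sum_(k < i.+1) chol G i k *: e k.
(* The basis vectors orthogonal to the span of phi. *)
Let psi k : H := if schurn G k k k == 0 then e k else 0.

Let phiE i n : (i < n)%N -> phi i = \sum_(k < n) chol G i k *: e k.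
Proof.
move=> lin; rewrite -(subnKC lin).
elim: (n - i.+1)%N => [|m IH]; first by rewrite addn0.
by rewrite addnS big_ord_recr /= -IH chol_upper ?leq_addr// scale0r addr0.
Qed.

Let dot_phi_e i n k : (i < n)%N -> (k < n)%N ->
  hdot H (phi i) (e k) = chol G i k.
Proof.
move=> lin kn; rewrite (phiE lin) dot_suml (bigD1 (Ordinal kn))//=.
rewrite dotZl e_orth eqxx mulr1 big1 ?addr0// => l /negPf lk.
by rewrite dotZl e_orth -[_ == k]/(l == Ordinal kn) lk mulr0.
Qed.

(** The vectors [phi] need not span a dense subspace; the [psi] fill the gap. They are orthogonal to
    every [phi], since column k of [chol] vanishes with its pivot, and a nonzero pivot lets e k be
    recovered from phi k and the earlier e l. *)
Lemma gram_realization_nat : exists (f g : nat -> H),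
  [/\ forall i j, hdot H (f i) (f j) = G i j,
      forall i k, hdot H (f i) (g k) = 0 &
      forall k, exists s,
        e k = comb (fun t : nat + nat =>
          match t with inl i => f i | inr k => g k end) s].
Proof.
exists phi, psi; split.
- move=> i j; pose n := (maxn i j).+1.
  have lin : (i < n)%N by rewrite ltnS leq_maxl.
  have ljn : (j < n)%N by rewrite ltnS leq_maxr.
  rewrite (phiE ljn) dot_sumr -(chol_gram j lin); apply: eq_bigr => k _.
  by rewrite dotZr (dot_phi_e lin)// mulrC.
- move=> i k; rewrite /psi; case: eqP => [k0|_]; last exact: dot0r.
  rewrite (@dot_phi_e _ (maxn i k).+1) ?ltnS ?leq_maxl ?leq_maxr//.
  by rewrite /chol k0 sqrtC0 invr0 mulr0.
move=> k; elim/ltn_ind: k => k IH.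
set x := fun t : nat + nat => _ in IH *.
have [k0|k0] := eqVneq (schurn G k k k) 0.
  by exists [:: (1, inr k)]; rewrite comb1 scale1r /= /psi k0 eqxx.
have ck : chol G k k != 0 by rewrite mulf_neq0 // invr_eq0 sqrtC_eq0.
have [s hs] : exists s, \sum_(l < k) chol G k l *: e l = comb x s.
  suff : forall m, (m <= k)%N ->
      exists s, \sum_(l < m) chol G k l *: e l = comb x s by exact.
  elim=> [_|m IHm mk]; first by exists [::]; rewrite /comb big_nil big_ord0.
  have [s hs] := IHm (ltnW mk); have [s' hs'] := IH m mk.
  exists (s ++ scale_comb (chol G k m) s').
  by rewrite big_ord_recr /= comb_cat comb_scale hs hs'.
exists (scale_comb (chol G k k)^-1 ((1, inl k) :: scale_comb (-1) s)).
rewrite comb_scale /comb big_cons -/(comb x _) comb_scale -hs scale1r /=.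
rewrite /phi big_ord_recr /= scaleN1r [X in X - _]addrC addrK.
by rewrite scalerA mulVf// scale1r.
Qed.

End PositiveKernel.

(** * Entrywise products with Cauchy kernels *)

Section CauchyKernel.
Variable R : realType.
Local Notation C := R[i].

(** Grouping the coefficients by the value [v] of [d] turns the form into a sum of squared
    moduli. *)
Lemma psd_eq (I T : eqType) (d : I -> T) :
  psd (fun i j => (d i == d j)%:R : C).
Proof.
split=> [i j|s]; first by rewrite rmorph_nat eq_sym.
pose D := undup [seq d t.2 | t <- s].
have -> : kform (fun i j => (d i == d j)%:R) s =
    \sum_(v <- D) `|\sum_(a <- s) a.1 * (d a.2 == v)%:R| ^+ 2.
  transitivity (\sum_(a <- s) \sum_(b <- s) \sum_(v <- D)
      (a.1 * (d a.2 == v)%:R) * (b.1 * (d b.2 == v)%:R)^*).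
    rewrite /kform !big_seq; apply: eq_bigr => a sa; apply: eq_bigr => b _.
    rewrite (bigD1_seq (d a.2)) ?undup_uniq//=; last first.
      by rewrite mem_undup; exact: map_f.
    rewrite eqxx mulr1 big1 ?addr0 => [|v]; last first.
      by rewrite eq_sym => /negPf ->; rewrite mulr0 mul0r.
    by rewrite rmorphM rmorph_nat mulrA [d a.2 == _]eq_sym.
  under eq_bigr do rewrite exchange_big.
  rewrite exchange_big; apply: eq_bigr => v _.
  rewrite normCK rmorph_sum mulr_suml; apply: eq_bigr => a _.
  by rewrite mulr_sumr.
by apply: sumr_ge0 => v _; rewrite exprn_ge0.
Qed.

Lemma kformD (I : Type) (G G' : I -> I -> C) s :
  kform (fun i j => G i j + G' i j) s = kform G s + kform G' s.
Proof.
rewrite -big_split; apply: eq_bigr => a _.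
by rewrite -big_split; apply: eq_bigr => b _; rewrite mulrDr.
Qed.

Lemma kformZ (I : Type) (G : I -> I -> C) (z : C) s :
  kform (fun i j => z * G i j) s = z * kform G s.
Proof.
rewrite mulr_sumr; apply: eq_bigr => a _.
by rewrite mulr_sumr; apply: eq_bigr => b _; rewrite mulrCA.
Qed.

Lemma kform_diag (I : Type) (G : I -> I -> C) (u : I -> C) s :
  kform (fun i j => u i * (u j)^* * G i j) s =
  kform G [seq (t.1 * u t.2, t.2) | t <- s].
Proof.
rewrite /kform big_map; apply: eq_bigr => a _; rewrite big_map.
by apply: eq_bigr => b _ /=; rewrite rmorphM; ring.
Qed.

Lemma psdD (I : Type) (G G' : I -> I -> C) :
  psd G -> psd G' -> psd (fun i j => G i j + G' i j).
Proof.
move=> [hG pG] [hG' pG']; split => [i j|s]; last by rewrite kformD addr_ge0.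
by rewrite rmorphD /= -hG -hG'.
Qed.

Lemma psdZ (I : Type) (G : I -> I -> C) (r : R) : 0 <= r ->
  psd G -> psd (fun i j => real_complex R r * G i j).
Proof.
move=> r0 [hG pG]; split=> [i j|s]; last by rewrite kformZ mulr_ge0// ler0c.
by rewrite rmorphM /= -hG conj_toC.
Qed.

Lemma Re_gt0_neq0 (z : C) : 0 < complex.Re z -> z != 0.
Proof. by apply: contraTneq => ->; rewrite ltxx. Qed.

(* With C(i,j) = 1/(x_i + conj x_j), the Schur complement of C at k is
   w_i conj(w_j) C(i,j) with w_k = 0, which removes one point. *)
Lemma psd_cauchy (I : Type) (G : I -> I -> C) (x : I -> C) :
  (forall i, 0 < complex.Re (x i)) -> psd G ->
  psd (fun i j => G i j / (x i + (x j)^*)).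
Proof.
move=> x0 [hG pG]; have xx i j : x i + (x j)^* != 0.
  by apply: Re_gt0_neq0; rewrite ReD Re_conj addr_gt0.
split=> [i j|].
  by rewrite rmorphM fmorphV rmorphD /= conjCK -hG addrC.
suff H n s : (size s <= n)%N ->
    0 <= kform (fun i j => G i j / (x i + (x j)^*)) s.
  by move=> s; exact: (H (size s)).
elim: n s => [|n IH] [|[c k] s]//=.
- by rewrite /kform big_nil.
- by rewrite /kform big_nil.
rewrite ltnS => sn.
pose t := x k + (x k)^*.
pose u i := (x i + (x k)^*)^-1.
pose w i := (x i - x k) * u i.
(* The first summand is [G] times C(i,k) C(k,j) / C(k,k), a positive multiple of a diagonal
   congruence of [G], hence positive; no general theorem on entrywise products is involved. *)
rewrite (eq_kform (G' := fun i j => t * (u i * (u j)^* * G i j) +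
    w i * (w j)^* * (G i j / (x i + (x j)^*)))); last first.
  move=> i j; rewrite /w /u /t !(rmorphM, rmorphB, fmorphV, rmorphD) /= !conjCK.
  move: (xx i j) (xx i k) (xx k j).
  move: (x i) (x j)^* (x k) (x k)^* => p q r v h1 h2 h3.
  by field; rewrite h1 h2 [q + r]addrC h3.
rewrite kformD kformZ !kform_diag addr_ge0//.
  by rewrite mulr_ge0 // /t [X in 0 <= X]addcJ mulr_ge0 ?ler0c// ltW.
have wk : w k = 0 by rewrite /w subrr mul0r.
rewrite /= kform_cons wk mulr0 conjC0 !mul0r !add0r.
by apply: IH; rewrite size_map.
Qed.

(** If [G] is the Gram matrix of vectors v(i,b), this is the Gram matrix of v(i,false) -
    v(i,true). *)
Lemma psd_diff (I : Type) (G : I * bool -> I * bool -> C) : psd G ->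
  psd (fun i j => G (i, false) (j, false) - G (i, false) (j, true)
                 - G (i, true) (j, false) + G (i, true) (j, true)).
Proof.
move=> [hG pG]; split=> [i j|s].
  rewrite rmorphD !rmorphB /= -!hG; ring.
have -> : kform (fun i j => G (i, false) (j, false) - G (i, false) (j, true)
    - G (i, true) (j, false) + G (i, true) (j, true)) s =
  kform G (flatten [seq [:: (t.1, (t.2, false)); (- t.1, (t.2, true))] | t <- s]);
  last exact: pG.
rewrite /kform big_flatten big_map; apply: eq_bigr => a _.
rewrite !big_cons big_nil /= addr0 !big_flatten !big_map -big_split.
apply: eq_bigr => b _; rewrite /= !big_cons !big_nil /= rmorphN; ring.
Qed.

End CauchyKernel.

(** * Normal operators and moment sequences *)

(** Log-convexity gives convexity by the arithmetic-geometric mean inequality, so a first increment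
    c > 0 would force d k >= k c. *)
Lemma logconvex_bounded_le (R : realType) (d : nat -> R) (b : R) :
  (forall k, 0 <= d k) -> (forall k, d k.+1 ^+ 2 <= d k * d k.+2) ->
  (forall k, d k <= b) -> d 1%N <= d 0%N.
Proof.
move=> d0 dc db; rewrite leNgt; apply/negP => d01.
pose c := d 1%N - d 0%N; have c0 : 0 < c by rewrite subr_gt0.
have convex k : 2 * d k.+1 <= d k + d k.+2.
  rewrite -(ler_pXn2r (n := 2)) ?nnegrE ?mulr_ge0 ?addr_ge0 ?d0//.
  by have := dc k; have := sqr_ge0 (d k - d k.+2); lra.
have incr k : c <= d k.+1 - d k.
  by elim: k => // k IH; have := convex k; lra.
have lin k : k%:R * c <= d k.
  elim: k => [|k IH]; first by rewrite mul0r.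
  by rewrite -natr1 mulrDl mul1r; have := incr k; lra.
have b0 : 0 <= b by exact: le_trans (d0 0%N) (db 0%N).
have := lin (Num.truncn (b / c)).+1; rewrite leNgt => /negP; apply.
by rewrite (le_lt_trans (db _))// -ltr_pdivrMr// truncnS_gt.
Qed.

Section Operators.
Variable R : realType.
Local Notation C := R[i].

Lemma normB_sq_le (u v : C) (c : R) : `|u| ^+ 2 <= toC c -> `|v| ^+ 2 <= toC c ->
  `|u - v| ^+ 2 <= toC (4 * c).
Proof.
rewrite !normc_sq !lecR; case: u v => [a b] [a' b'] /=.
have := sqr_ge0 (a + a'); have := sqr_ge0 (b + b'); lra.
Qed.

Lemma dense_form_eq0 (I J : Type) (H K : hilbert R) (x : I -> H) (y : J -> K)
    (b : H -> K -> C) (c : R) :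
  dense x -> dense y ->
  (forall a f f' g, b (a *: f + f') g = a * b f g + b f' g) ->
  (forall a f g g', b f (a *: g + g') = a^* * b f g + b f g') ->
  (forall f g, `|b f g| ^+ 2 <= toC (c * (nsq f * nsq g))) ->
  (forall i j, b (x i) (y j) = 0) -> forall f g, b f g = 0.
Proof.
move=> dx dy linl linr bd b0.
have bj f j : b f (y j) = 0.
  apply: (@dense_functional_eq0 _ _ _ _ dx (b^~ (y j)) (c * nsq (y j))) => //.
  by move=> u; rewrite -mulrA [nsq _ * nsq u]mulrC.
move=> f g; apply: (can_inj (@conjCK _)); rewrite conjC0.
apply: (@dense_functional_eq0 _ _ _ _ dy (fun g => (b f g)^*) (c * nsq f)).
- by move=> a u v; rewrite linr rmorphD rmorphM /= conjCK.
- by move=> u; rewrite norm_conjC -mulrA bd.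
by move=> j; rewrite bj conjC0.
Qed.

Section Contraction.
Variables (H : hilbert R) (I : Type) (phi : I -> H) (sg sg' : I -> I).
Hypothesis adj : forall i j, hdot H (phi (sg i)) (phi j) =
  hdot H (phi i) (phi (sg' j)).
Hypothesis sgC : forall i, sg (sg' i) = sg' (sg i).
Variable B : R.
Hypothesis bound : forall i j, `|hdot H (phi i) (phi j)| <= toC B.

(** A norm inequality for a shift that is not yet an operator. On formal combinations [adj] and
    [sgC] say that it is normal, so the squared norms [d k] of the iterates are log-convex by
    Cauchy-Schwarz; the bound on the Gram entries bounds them. *)
Lemma shift_contraction s : nsq (comb (phi \o sg) s) <= nsq (comb phi s).
Proof.
have nsq_sg' (f : I -> I) :
    nsq (comb (phi \o (sg' \o f)) s) = nsq (comb (phi \o (sg \o f)) s).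
  apply: (@complexI R); rewrite !nsq_comb; apply: eq_kform => i j /=.
  by rewrite [RHS]adj [RHS]dotC -sgC adj [LHS]dotC.
pose d k := nsq (comb (phi \o iter k sg) s).
apply: (@logconvex_bounded_le R d
  (complex.Re (\sum_(a <- s) \sum_(b <- s) `|a.1| * `|b.1| * toC B))) => k.
- exact: nsq_ge0.
- have -> : d k.+1 = complex.Re (hdot H (comb (phi \o iter k sg) s)
      (comb (phi \o (sg' \o iter k.+1 sg)) s)).
    rewrite /d /nsq /comb !dot_suml; congr complex.Re; apply: eq_bigr => a _.
    rewrite !dot_sumr; apply: eq_bigr => b _.
    by rewrite !dotZl !dotZr /= adj.
  by apply: le_trans (CS_Re _ _) _; rewrite nsq_sg'.
have : toC (d k) <= \sum_(a <- s) \sum_(b <- s) `|a.1| * `|b.1| * toC B.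
  rewrite -[toC _]ger0_norm ?ler0c ?nsq_ge0// nsq_comb.
  apply: le_trans (ler_norm_sum _ _ _) _; apply: ler_sum => a _.
  apply: le_trans (ler_norm_sum _ _ _) _; apply: ler_sum => b _.
  rewrite !normrM norm_conjC; apply: ler_wpM2l; last exact: bound.
  by rewrite mulr_ge0.
by rewrite lecE => /andP[_].
Qed.

End Contraction.

Variables (H : hilbert R) (e : nat -> H).
Hypothesis e_orth : forall i j, hdot H (e i) (e j) = (i == j)%:R.
Hypothesis e_dense : dense e.

Lemma dense_trans (I J : Type) (x : I -> H) (y : J -> H) :
  dense x -> (forall i, exists s, x i = comb y s) -> dense y.
Proof.
move=> dx /choice[c hc] f eps e0; have [s hs] := dx f eps e0.
exists (flatten [seq scale_comb t.1 (c t.2) | t <- s]).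
suff -> : comb y (flatten [seq scale_comb t.1 (c t.2) | t <- s]) = comb x s.
  by [].
elim: s {hs} => [|t s IH] /=; first by rewrite /comb !big_nil.
by rewrite comb_cat comb_scale -hc IH /comb big_cons.
Qed.

Variables (I : countType) (i0 : I) (G : I -> I -> C) (sg sg' : I -> I) (B : R).
Hypothesis G_psd : psd G.
Hypothesis G_adj : forall i j, G (sg i) j = G i (sg' j).
Hypothesis sgC : forall i, sg (sg' i) = sg' (sg i).
Hypothesis G_bound : forall i j, `|G i j| <= toC B.

(** [N] shifts the realizing vectors by [sg], its adjoint by [sg'], and both vanish on the
    orthogonal complement. They extend the maps [x t -> xl (lift _ t)], where [xl] is the projection
    of [x] to the closed span of the realizing vectors; all identities are checked on the dense
    family [x]. *)
Lemma normal_op_of_kernel : exists (phi : I -> H) (N : {linear H -> H}),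
  [/\ forall i j, hdot H (phi i) (phi j) = G i j, normal_op N,
      forall u, nsq (N u) <= nsq u & forall i, N (phi i) = phi (sg i)].
Proof.
(* Numbers that encode no index are read as [i0]: the pulled-back kernel stays positive, it merely
   repeats a vector. *)
pose dec a := odflt i0 (unpickle a).
have decK i : dec (pickle i) = i by rewrite /dec pickleK.
have B0 : 0 <= toC B by exact: le_trans (normr_ge0 _) (G_bound i0 i0).
have [f [g [fG fg efg]]] :=
  gram_realization_nat (psd_comp dec G_psd) e_orth.
set x := fun t : nat + nat => _ in efg.
have x_dense := dense_trans e_dense efg.
pose xl (t : nat + nat) := if t is inl a then f a else 0.
pose lift (tau : I -> I) (t : nat + nat) : nat + nat :=
  if t is inl a then inl (pickle (tau (dec a))) else t.
have dot_xl_x t t' : hdot H (xl t) (x t') = hdot H (xl t) (xl t').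
  by case: t t' => [a|k] [b|l] /=; rewrite ?dot0l ?dot0r ?fg.
have dot_x_xl t t' : hdot H (x t) (xl t') = hdot H (xl t) (xl t').
  by rewrite dotC dot_xl_x -dotC.
have xl_bound t t' : `|hdot H (xl t) (xl t')| <= toC B.
  by case: t t' => [a|k] [b|l] /=; rewrite ?dot0l ?dot0r ?normr0 ?fG.
have le_xl s : nsq (comb xl s) <= nsq (comb x s).
  pose xr (t : nat + nat) := if t is inr k then g k else 0.
  have -> : comb x s = comb xl s + comb xr s.
    rewrite /comb -big_split; apply: eq_bigr => -[c [a|k]] _ /=.
      by rewrite scaler0 addr0.
    by rewrite scaler0 add0r.
  rewrite nsqD_orth ?lerDl ?nsq_ge0// /comb dot_suml big1 // => -[c [a|k]] _.
    rewrite dot_sumr big1// => -[c' [b|l]] _ /=; rewrite dotZl dotZr.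
      by rewrite dot0r !mulr0.
    by rewrite fg !mulr0.
  by rewrite scaler0 dot0l.
have op (t1 t2 : I -> I) : (forall i j, G (t1 i) j = G i (t2 j)) ->
    (forall i, t1 (t2 i) = t2 (t1 i)) ->
    exists L : {linear H -> H}, (forall t, L (x t) = xl (lift t1 t)) /\
      forall u, nsq (L u) <= nsq u.
  move=> adj tC; apply: contraction_extension x_dense => s.
  apply: le_trans (le_xl s).
  apply: (@shift_contraction H _ xl (lift t1) (lift t2) _ _ B) => //.
    by move=> [a|k] [b|l] /=; rewrite ?dot0l ?dot0r// !fG !decK adj.
  by move=> [a|k] //=; rewrite !decK tC.
have [N [Nx N1]] := op _ _ G_adj sgC.
have [|M [Mx M1]] := op sg' sg _ (fun i => esym (sgC i)).
  have [hG _] := G_psd.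
  by move=> i j; rewrite hG -G_adj -hG.
have NM : is_adjoint N M.
  move=> u v; apply/eqP; rewrite -subr_eq0; apply/eqP.
  apply: (@dense_form_eq0 _ _ H H x x
    (fun u v => hdot H (N u) v - hdot H u (M v)) 4 x_dense x_dense).
  - by move=> a p q w; rewrite linearP !dotDl !dotZl; ring.
  - by move=> a p q w; rewrite linearP !dotDr !dotZr; ring.
  - move=> p q; apply: normB_sq_le; apply: le_trans (CS _ _) _; rewrite lecR.
      by rewrite ler_wpM2r ?nsq_ge0.
    by rewrite ler_wpM2l ?nsq_ge0.
  move=> t t'; rewrite Nx Mx dot_xl_x dot_x_xl; apply/eqP; rewrite subr_eq0.
  case: t t' => [a|k] [b|l] /=; rewrite ?dot0l ?dot0r// !fG !decK.
  by rewrite G_adj.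
have Nxl t : N (xl t) = xl (lift sg t).
  by case: t => [a|k]; [exact: (Nx (inl a))|rewrite linear0].
have Mxl t : M (xl t) = xl (lift sg' t).
  by case: t => [a|k]; [exact: (Mx (inl a))|rewrite linear0].
exists (fun i => f (pickle i)), N; split.
- by move=> i j; rewrite fG !decK.
- split; first exact: contraction_continuous.
  exists M; split=> // u; apply/eqP; rewrite -subr_eq0; apply/eqP.
  apply: nsq_eq0; rewrite /nsq; set w := (X in hdot H _ X).
  have -> : hdot H (N (M u) - M (N u)) w = 0.
    apply: (@dense_functional_eq0 _ _ _ _ x_dense
      (fun u => hdot H (N (M u) - M (N u)) w) (4 * nsq w)).
    - move=> a p q; rewrite !linearP -dotZl -dotDl; congr (hdot H _ w).
      by rewrite addrACA -scalerDr.
    - move=> p; rewrite dotBl -mulrA; apply: normB_sq_le;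
        apply: le_trans (CS _ _) _; rewrite lecR mulrC ler_wpM2l ?nsq_ge0//.
        exact: le_trans (N1 _) (M1 _).
      exact: le_trans (M1 _) (N1 _).
    move=> t; rewrite Mx Nx Nxl Mxl.
    suff -> : lift sg (lift sg' t) = lift sg' (lift sg t).
      by rewrite subrr dot0l.
    by case: t => [a|k] //=; rewrite !decK sgC.
  by [].
- exact: N1.
by move=> i; rewrite -[f (pickle i)]/(xl (inl (pickle i))) Nxl /= decK.
Qed.

End Operators.

(** The operator (1 - E)^n, E the forward shift, applied to [b] at [k]. With this sign the
    completely monotone sequences are those with all values nonnegative. *)
Fixpoint dlt (V : zmodType) (b : nat -> V) n k : V :=
  if n is m.+1 then dlt b m k - dlt b m k.+1 else b k.

Section Subnormal.
Variable R : realType.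
Local Notation C := R[i].

(** Put P = 1 - N*N, self-adjoint and commuting with N, and h = P^j g. The difference is Re <P^n g,
    g>: |h|^2 for n = 2j, and |h|^2 - |N h|^2 for n = 2j + 1. [N] may have norm above 1; only the
    orbit of [g], hence that of h, is bounded, which is what [logconvex_bounded_le] asks for. *)
Lemma normal_dlt_ge0 (K : hilbert R) (N : {linear K -> K}) (g : K) (B : R) n :
  normal_op N -> (forall k, nsq (iter k N g) <= B) ->
  0 <= dlt (fun k => nsq (iter k N g)) n 0.
Proof.
move=> [_ [M [adj NM]]] bd.
have adj' u w : hdot K (M u) w = hdot K u (N w) by rewrite dotC -adj -dotC.
have nsqM u : nsq (M u) = nsq (N u).
  by rewrite /nsq -adj NM adj'.
pose A u := M (N u); pose P u := u - A u.
have AE k u : nsq (iter k N u) = complex.Re (hdot K (iter k A u) u).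
  elim: k u => [//|k IH] u; rewrite iterSr IH.
  have -> : iter k.+1 A u = M (iter k A (N u)).
    by elim: k {IH} => //= k ->; rewrite /A NM.
  by rewrite adj'.
have PE m k u : dlt (fun k => complex.Re (hdot K (iter k A u) u)) m k =
    complex.Re (hdot K (iter m P (iter k A u)) u).
  have iterPA j w : iter j P (A w) = A (iter j P w).
    by elim: j => //= j ->; rewrite /P /A !linearB.
  elim: m k => //= m IH k; rewrite !IH iterS iterPA /P dotBl ReD ReN //.
have Psym u w : hdot K (P u) w = hdot K u (P w).
  by rewrite /P dotBl dotBr /A adj' adj.
have Pn m u w : hdot K (iter m P u) w = hdot K u (iter m P w).
  by elim: m u w => // m IH u w; rewrite iterS Psym IH -iterSr.
have NP u : N (P u) = P (N u) by rewrite /P /A linearB NM.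
have -> : dlt (fun k => nsq (iter k N g)) n 0 =
    complex.Re (hdot K (iter n P g) g).
  rewrite -(PE n 0%N); congr dlt; apply/funext => k; exact: AE.
rewrite -(odd_double_half n) -addnn; set j := n./2.
pose h := iter j P g.
have hh : complex.Re (hdot K (iter (j + j) P g) g) = nsq h.
  by rewrite iterD Pn.
case: (odd n); last by rewrite add0n hh nsq_ge0.
have -> : complex.Re (hdot K (iter (1 + (j + j)) P g) g) = nsq h - nsq (N h).
  rewrite add1n iterSr iterD Pn.
  have -> : iter j P (P g) = P h by rewrite -iterSr iterS.
  by rewrite /P dotBl ReD ReN /A adj'.
rewrite subr_ge0.
have [c hc] : exists c, forall k, nsq (iter k N h) <= c.
  rewrite /h; elim: j {h hh} => [|j [c hc]]; first by exists B.
  exists (4 * c) => k; rewrite iterS.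
  have -> : iter k N (P (iter j P g)) = P (iter k N (iter j P g)).
    by elim: k => //= k ->; rewrite NP.
  apply: le_trans (nsqB_le _ _) _; rewrite /A nsqM.
  by have := hc k; have := hc k.+2; rewrite !iterS; lra.
apply: (@logconvex_bounded_le R (fun k => nsq (iter k N h)) c) => // k.
  exact: nsq_ge0.
have -> : nsq (iter k.+1 N h) =
    complex.Re (hdot K (iter k N h) (M (iter k.+1 N h))).
  by rewrite -adj.
by apply: le_trans (CS_Re _ _) _; rewrite nsqM.
Qed.

Lemma subnormal_dlt_ge0 (H : hilbert R) (T : {linear H -> H}) (v : H) (B : R) n :
  subnormal_op T -> (forall k, nsq (iter k T v) <= B) ->
  0 <= dlt (fun k => nsq (iter k T v)) n 0.
Proof.
move=> [K [J [N [Jiso Nnormal NJ]]]] bd.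
have nJ u : nsq (J u) = nsq u by rewrite /nsq Jiso.
have itN k : iter k N (J v) = J (iter k T v) by elim: k => //= k ->.
have -> : (fun k => nsq (iter k T v)) = (fun k => nsq (iter k N (J v))).
  by apply/funext => k; rewrite itN nJ.
by apply: (@normal_dlt_ge0 K N (J v) B) => // k; rewrite itN nJ.
Qed.

End Subnormal.

(** * Sequences that are not completely monotone *)

Section Differences.

Lemma dltD (V : zmodType) (a b : nat -> V) n k :
  dlt (fun k => a k + b k) n k = dlt a n k + dlt b n k.
Proof. by elim: n k => //= n IH k; rewrite !IH opprD addrACA. Qed.

Lemma dltZ (F : pzRingType) (c : F) (a : nat -> F) n k :
  dlt (fun k => c * a k) n k = c * dlt a n k.
Proof. by elim: n k => //= n IH k; rewrite !IH mulrBr. Qed.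

Lemma dlt_raddf (V W : zmodType) (f : {additive V -> W}) (a : nat -> V) n k :
  dlt (fun k => f (a k)) n k = f (dlt a n k).
Proof. by elim: n k => //= n IH k; rewrite !IH raddfB. Qed.

Lemma eq_dlt (V : zmodType) (a b : nat -> V) n k :
  a =1 b -> dlt a n k = dlt b n k.
Proof. by move=> ab; elim: n k => //= n IH k; rewrite !IH. Qed.

Lemma dlt_cst (V : zmodType) (c : V) n k : dlt (fun=> c) n.+1 k = 0.
Proof.
elim: n k => [|n IH] k; first by rewrite /= subrr.
by rewrite -[LHS]/(dlt _ n.+1 k - dlt _ n.+1 k.+1) !IH subrr.
Qed.

(** The Leibniz rule for a linear factor. It turns a denominator k + w into a first order recursion
    in [n] for the differences. *)
Lemma dlt_mul (F : comPzRingType) (a : nat -> F) (w : F) n k :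
  dlt (fun k => (k%:R + w) * a k) n.+1 k =
  (k%:R + w + n.+1%:R) * dlt a n.+1 k - n.+1%:R * dlt a n k.
Proof.
elim: n k => [|n IH] k; first by rewrite /= -!natr1; ring.
by rewrite -[LHS]/(dlt _ n.+1 k - dlt _ n.+1 k.+1) !IH /= -!natr1; ring.
Qed.

(** The consecutive ratio of the numbers n! / (v (v+1) ... (v+n)), found by applying [dlt_mul] to (k
    + v) / (k + v) = 1. *)
Lemma dlt_recip (F : fieldType) (v : F) n : (forall k, k%:R + v != 0) ->
  dlt (fun k => (k%:R + v)^-1) n.+1 0 =
  dlt (fun k => (k%:R + v)^-1) n 0 * (n.+1%:R / (n.+1%:R + v)).
Proof.
move=> v0; have := dlt_mul (fun k => (k%:R + v)^-1) v n 0.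
rewrite (eq_dlt _ _ (b := fun=> 1)) ?dlt_cst => [|k]; last by rewrite divff.
rewrite add0r => /eqP; rewrite eq_sym subr_eq0 => /eqP h.
by rewrite mulrA [_ * n.+1%:R]mulrC -h addrC mulrAC divff// mul1r.
Qed.

End Differences.

Lemma harmonic_unbounded (R : realType) (c : R) :
  exists n, c < \sum_(k < n) k.+1%:R^-1.
Proof.
apply: contrapT => h; apply: (@dvg_harmonic R).
apply: nondecreasing_is_cvgn.
  apply/nondecreasing_seqP => n; rewrite /series /= big_nat_recr//= lerDl.
  by rewrite /harmonic /= invr_ge0.
exists c => _ [n _ <-]; rewrite leNgt; apply/negP => hn; apply: h; exists n.
by move: hn; rewrite /series /= big_mkord.
Qed.

(* With D_n, U_n, V_n the n-th differences at 0 of a, (k+1) a and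
   (k+1)(k-r1) a, one has V_n < 0 and U_n / - V_n decreases at least like the
   harmonic series; so U_n, and then (n+1) D_n = U_0 + ... + U_n, is
   eventually negative. *)
Lemma positive_roots_not_cm (R : realType) (c r1 r2 : R) :
  0 < c -> 0 < r1 -> r1 <= r2 -> r2 < 1 ->
  ~ forall n, 0 <= dlt (fun k => c / ((k%:R + 1) * (k%:R - r1) * (k%:R - r2))) n 0.
Proof.
move=> c0 r10 r12 r21.
set a := (X in dlt X) => D0.
pose v k : R := c / (k%:R - r2); pose u k := v k / (k%:R - r1).
have nr r k : 0 < r -> r < 1 -> k%:R - r != 0 :> R.
  move=> r0 r1'; rewrite subr_eq0; apply/eqP; case: k => [|k] kr.
    by rewrite -kr ltxx in r0.
  by move: r1'; rewrite -kr -natr1 gtrDr ltNge ler0n.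
have n1 k r : r < 1 -> 0 < k.+1%:R - r :> R.
  by move=> r1'; rewrite -natr1; have := ler0n R k; lra.
have r11 : r1 < 1 by exact: le_lt_trans r21.
have r20 : 0 < r2 by exact: lt_le_trans r12.
pose V n := dlt v n 0; pose U n := dlt u n 0; pose D n := dlt a n 0.
have VS n : (n.+1%:R - r2) * V n.+1 = n.+1%:R * V n.
  have := dlt_mul v (- r2) n 0; rewrite (eq_dlt _ _ (b := fun=> c)); last first.
    by move=> k; rewrite /v mulrC divfK// nr.
  rewrite dlt_cst add0r [- r2 + _]addrC => /eqP.
  by rewrite eq_sym subr_eq0 => /eqP.
have US n : (n.+1%:R - r1) * U n.+1 = n.+1%:R * U n + V n.+1.
  have := dlt_mul u (- r1) n 0; rewrite (eq_dlt _ _ (b := v)); last first.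
    by move=> k; rewrite /u mulrC divfK// nr.
  by rewrite add0r [- r1 + _]addrC -/(V _) -/(U _) -/(U _) => ->; ring.
have DS n : n.+2%:R * D n.+1 = n.+1%:R * D n + U n.+1.
  have := dlt_mul a 1 n 0; rewrite (eq_dlt _ _ (b := u)); last first.
    move=> k; have k1 : k%:R + 1 != 0 :> R by rewrite natr1 pnatr_eq0.
    by rewrite /a /u /v; field; rewrite k1 !nr.
  by rewrite add0r [1 + _]addrC natr1 -/(U _) -/(D _) -/(D _) => ->; ring.
have Vneg n : V n <= V 0%N /\ V n < 0.
  have V00 : V 0%N < 0.
    by rewrite /V /= /v sub0r invrN mulrN oppr_lt0 divr_gt0.
  elim: n => // n [IH1 IH2]; have p := n1 n _ r21.
  have VV : V n.+1 <= V n.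
    rewrite -(ler_pM2l p) VS; have : 0 < r2 * - V n by rewrite mulr_gt0// oppr_gt0.
    lra.
  by split; [exact: le_trans VV IH1|exact: le_lt_trans VV IH2].
have [n0 Un0] : exists n, U n <= 0.
  apply: contrapT => hU.
  have Upos n : 0 < U n by rewrite ltNge; apply/negP => h; apply: hU; exists n.
  pose y n := U n / - V n.
  have y0 n : 0 < y n by rewrite divr_gt0// oppr_gt0; case: (Vneg n).
  (* The recursions give (n+1-r1) y(n+1) = (n+1-r2) y(n) - 1. Here r1 <= r2 lets r1 replace r2, and
     r1 > 0 makes the drop at least 1/(n+1). *)
  have yS n : y n.+1 <= y n - n.+1%:R^-1.
    have p1 := n1 n _ r11; have p2 := n1 n _ r21.
    have Vn : V n != 0 by case: (Vneg n) => _ h; rewrite lt_eqF.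
    have Vn1 : V n.+1 != 0 by case: (Vneg n.+1) => _ h; rewrite lt_eqF.
    have VE : V n = (n.+1%:R - r2) * V n.+1 / n.+1%:R.
      by rewrite VS [n.+1%:R * _]mulrC mulfK// pnatr_eq0.
    have yE : (n.+1%:R - r1) * y n.+1 = (n.+1%:R - r2) * y n - 1.
      have q0 : n.+1%:R != 0 :> R by rewrite pnatr_eq0.
      have p20 : n.+1%:R - r2 != 0 by rewrite gt_eqF.
      rewrite /y mulrA US VE; move: (V n.+1) (U n) (n.+1%:R) q0 p20 Vn1.
      by move=> p q m m0 mr p0; field; rewrite m0 mr p0.
    rewrite -(ler_pM2l p1) yE mulrBr.
    have : (n.+1%:R - r2) * y n <= (n.+1%:R - r1) * y n.
      by rewrite ler_pM2r// lerD2l lerN2.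
    have : (n.+1%:R - r1) / n.+1%:R <= 1.
      by rewrite ler_pdivrMr ?ltr0n// mul1r; lra.
    by move: (n.+1%:R) (y n) => p q; lra.
  have yH n : y n <= y 0%N - \sum_(k < n) k.+1%:R^-1.
    elim: n => [|n IH]; first by rewrite big_ord0 subr0.
    rewrite big_ord_recr /=; have := yS n.
    by move: (\sum_(_ < n) _) IH n.+1%:R^-1 => p IH q; lra.
  have [n hn] := harmonic_unbounded (y 0%N).
  by have := yH n; have := y0 n; lra.
have USneg n : U n <= 0 -> U n.+1 < 0.
  move=> Un; have p := n1 n _ r11; rewrite -(pmulr_rlt0 _ p) US.
  have : n.+1%:R * U n <= 0 by rewrite mulr_ge0_le0.
  by case: (Vneg n.+1) => _; lra.
pose et := - U n0.+1; have et0 : 0 < et by rewrite oppr_gt0 USneg.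
(* As long as U k <= 0, the identity (k+1-r1) (U (k+1) - U k) = r1 U k + V (k+1) makes [U] decrease
   further. *)
have Ule m : U (n0.+1 + m)%N <= - et.
  rewrite /et opprK; elim: m => [|m IH]; first by rewrite addn0.
  apply: le_trans (IH); rewrite addnS; set k := (n0.+1 + m)%N in IH *.
  have Uk : U k <= 0 by have := USneg _ Un0; have := IH; lra.
  have p := n1 k _ r11; rewrite -(ler_pM2l p) US.
  have : 0 <= r1 * - U k by rewrite mulr_ge0 ?oppr_ge0// ltW.
  by case: (Vneg k.+1) => _; lra.
have Dle m : (n0 + m).+1%:R * D (n0 + m)%N <= n0.+1%:R * D n0 - m%:R * et.
  elim: m => [|m IH]; first by rewrite addn0 mul0r subr0.
  rewrite addnS DS; have := Ule m; rewrite addSn -natr1; lra.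
pose m := (Num.truncn (n0.+1%:R * D n0 / et)).+1.
have : 0 <= (n0 + m).+1%:R * D (n0 + m)%N by rewrite mulr_ge0// D0.
have := Dle m; have : n0.+1%:R * D n0 < m%:R * et.
  by rewrite -ltr_pdivrMr// truncnS_gt.
lra.
Qed.

(** * Pochhammer quotients and non-real roots *)

Section Oscillation.
Variable R : realType.
Local Notation C := R[i].

(** The Pochhammer quotient (u)_n / (v)_n; for v = 1 it is the weight (u)_n / n!. *)
Definition ratio_prod (u v : C) n : C := \prod_(j < n) ((u + j%:R) / (v + j%:R)).

Lemma ratio_prodS u v n :
  ratio_prod u v n.+1 = ratio_prod u v n * ((u + n%:R) / (v + n%:R)).
Proof. by rewrite /ratio_prod big_ord_recr. Qed.

(** The n-th difference of 1/(k + v) is n! / (v)_(n+1), so n! cancels against the weight. *)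
Lemma ratio_prod_recip u v n : (forall j, v + j%:R != 0) ->
  ratio_prod u 1 n * dlt (fun k => (k%:R + v)^-1) n 0 =
  ratio_prod u v n / (v + n%:R).
Proof.
move=> v0; have v0' j : j%:R + v != 0 by rewrite addrC.
elim: n => [|n IH].
  by rewrite /ratio_prod !big_ord0 !mul1r /= addr0 add0r.
rewrite !ratio_prodS dlt_recip// mulrACA IH.
rewrite nat1r [v + n.+1%:R]addrC.
have n0 : n.+1%:R != 0 :> C by rewrite pnatr_eq0.
move: (v0 n) (v0' n.+1) n0; move: (ratio_prod u v n) (n.+1%:R) (n%:R) => p a b.
by move=> h1 h2 h3; field; rewrite h1 h2 h3.
Qed.

(** For p_k = (u)_k / (v)_k one has p_(k+1) - p_k = (u - v) p_k / (v + k). The excluded case u = v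
    is the resonant one, where the sum diverges. *)
Lemma ratio_prod_telescope u v n : (forall j, v + j%:R != 0) -> v != u ->
  \sum_(k < n) ratio_prod u v k / (v + k%:R) = (1 - ratio_prod u v n) / (v - u).
Proof.
move=> v0 vu; have vu0 : v - u != 0 by rewrite subr_eq0.
elim: n => [|n IH]; first by rewrite big_ord0 /ratio_prod big_ord0 subrr mul0r.
rewrite big_ord_recr /= IH ratio_prodS; move: (v0 n) vu0.
by move: (ratio_prod u v n) (n%:R) => p b h1 h2; field; rewrite h1 h2.
Qed.

Lemma ratio_prod_le1 u v n : (forall j, v + j%:R != 0) ->
  (forall j : nat, `|u + j%:R| <= `|v + j%:R|) -> `|ratio_prod u v n| <= 1.
Proof.
move=> v0 uv; rewrite normr_prod prodr_ile1// => j _.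
by rewrite normr_ge0 normf_div ler_pdivrMr ?normr_gt0// mul1r uv.
Qed.

Lemma ratio_prodM u v w n : (forall j, v + j%:R != 0) ->
  ratio_prod u w n = ratio_prod u v n * ratio_prod v w n.
Proof.
move=> v0; rewrite /ratio_prod -big_split; apply: eq_bigr => j _ /=.
by rewrite mulrA divfK.
Qed.

Lemma Re_shift (w : C) (j : nat) :
  complex.Re (w + j%:R) = complex.Re w + j%:R.
Proof. by rewrite -(rmorph_nat toC) ReD. Qed.

Lemma Im_shift (w : C) (j : nat) : complex.Im (w + j%:R) = complex.Im w.
Proof. by rewrite -(rmorph_nat toC); case: w => a b /=; rewrite addr0. Qed.

Lemma norm_shift_sq (w : C) (j : nat) : `|w + j%:R| ^+ 2 =
  toC ((complex.Re w + j%:R) ^+ 2 + complex.Im w ^+ 2).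
Proof. by rewrite normc_sq Re_shift Im_shift. Qed.

(** The squared modulus is the product of the 1 + y^2 / (s+j)^2, at most the exponential of their
    sum. [m] is chosen so that y^2 / (s+j)^2 <= m (1/(s+j) - 1/(s+j+1)), whose sum telescopes to
    [q]. *)
Lemma ratio_prod_bound (w : C) : 0 < complex.Re w ->
  exists2 c : R, 0 <= c &
    forall n, `|ratio_prod w (toC (complex.Re w)) n| <= toC c.
Proof.
set s := complex.Re w; set y := complex.Im w => s0.
pose m := y ^+ 2 * (1 + s^-1).
pose q n := m * (s^-1 - (s + n%:R)^-1).
have sn (n : nat) : 0 < s + n%:R by rewrite ltr_wpDr.
have sq n : `|ratio_prod w (toC s) n| ^+ 2 <= toC (expR (q n)).
  elim: n => [|n IH].
    by rewrite /ratio_prod big_ord0 normr1 expr1n /q addr0 subrr mulr0 expR0.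
  rewrite ratio_prodS normrM exprMn.
  have -> : q n.+1 = q n + m * ((s + n%:R)^-1 - (s + n.+1%:R)^-1).
    by rewrite /q -mulrDr addrC addrA subrK addrC.
  rewrite expRD rmorphM ler_pM ?exprn_ge0 ?normr_ge0//.
  rewrite normf_div expr_div_n !norm_shift_sq /= -/s -/y expr0n /= addr0.
  rewrite -fmorphV -rmorphM lecR (le_trans _ (expR_ge1Dx _))//.
  have p := sn n; have p1 := sn n.+1.
  rewrite mulrDl divff ?lerD2l; last by rewrite expf_neq0// gt_eqF.
  rewrite -subr_ge0.
  have -> : m * ((s + n%:R)^-1 - (s + n.+1%:R)^-1) - y ^+ 2 / (s + n%:R) ^+ 2 =
      y ^+ 2 * n%:R / (s * (s + n%:R) ^+ 2 * (s + n.+1%:R)).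
    rewrite /m; rewrite -natr1 in p1 *; field.
    by apply/and3P; split; apply: lt0r_neq0.
  apply: divr_ge0; first exact: mulr_ge0 (sqr_ge0 _) (ler0n _ _).
  exact: mulr_ge0 (mulr_ge0 (ltW s0) (sqr_ge0 _)) (ltW p1).
have m0 : 0 <= m by rewrite mulr_ge0 ?sqr_ge0// addr_ge0// invr_ge0 ltW.
exists (Num.sqrt (expR (m / s))); first exact: sqrtr_ge0.
move=> n; rewrite -(ler_pXn2r (n := 2)) ?nnegrE ?normr_ge0 ?ler0c ?sqrtr_ge0//.
have -> : toC (Num.sqrt (expR (m / s))) ^+ 2 = toC (expR (m / s)).
  by rewrite -(rmorphXn toC) sqr_sqrtr ?expR_ge0.
apply: le_trans (sq n) _.
by rewrite lecR ler_expR /q ler_wpM2l// gerBl invr_ge0 (ltW (sn n)).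
Qed.

Lemma sum_shift_recip_unbounded (w : C) (c : R) : 0 < complex.Re w ->
  exists n, ~ `|\sum_(k < n) (w + k%:R)^-1| <= toC c.
Proof.
set s := complex.Re w; set y := complex.Im w => s0.
(* Chosen so that (s+k)^2 + y^2 <= d (k+1) (s+k), that is, Re 1/(w+k) >= 1 / (d (k+1)). *)
pose d := 1 + s + y ^+ 2 / s.
have d0 : 0 < d.
  by rewrite /d -addrA ltr_pwDl// addr_ge0 ?(ltW s0)// divr_ge0 ?sqr_ge0 ?(ltW s0).
have [n hn] := harmonic_unbounded (d * `|c|); exists n => h.
have Resum (F : nat -> C) m : complex.Re (\sum_(k < m) F k) =
    \sum_(k < m) complex.Re (F k).
  elim: m => [|m IH]; first by rewrite !big_ord0.
  by rewrite !big_ord_recr ReD IH.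
have : complex.Re (\sum_(k < n) (w + k%:R)^-1) <= c.
  rewrite -lecR; apply: le_trans _ h; apply: le_trans _ (normc_ge_Re _).
  by rewrite lecR ler_norm.
rewrite (Resum (fun k => (w + k%:R)^-1)) => hc.
suff : \sum_(k < n) k.+1%:R^-1 <= d * \sum_(k < n) complex.Re (w + k%:R)^-1.
  have : d * \sum_(k < n) complex.Re (w + k%:R)^-1 <= d * `|c|.
    by rewrite ler_pM2l// (le_trans hc)// ler_norm.
  lra.
rewrite mulr_sumr; apply: ler_sum => k _.
have -> : complex.Re (w + k%:R)^-1 = (s + k%:R) / ((s + k%:R) ^+ 2 + y ^+ 2).
  by rewrite -[s + _]Re_shift -[y](Im_shift w k); case: (w + k%:R).
have k0 := ler0n R k; have k1 : 0 < k.+1%:R :> R by rewrite ltr0n.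
have D : 0 < (s + k%:R) ^+ 2 + y ^+ 2.
  by rewrite ltr_pwDl ?sqr_ge0// exprn_gt0// ltr_wpDr.
rewrite mulrA ler_pdivlMr// mulrC ler_pdivrMr//.
have ys : y ^+ 2 / s * s = y ^+ 2 by rewrite divfK// gt_eqF.
have ys0 : 0 <= y ^+ 2 / s by rewrite divr_ge0 ?sqr_ge0 ?(ltW s0).
move: ys ys0; rewrite /d -natr1; move: (y ^+ 2 / s) => t ys t0.
have : 0 <= t * (k%:R * s) by rewrite !mulr_ge0 ?(ltW s0).
have : 0 <= t * (k%:R * k%:R) by rewrite !mulr_ge0.
have : 0 <= t * k%:R by rewrite !mulr_ge0.
have : 0 <= s * (k%:R * k%:R) by rewrite !mulr_ge0 ?(ltW s0).
have : 0 <= s * (k%:R * s) by rewrite !mulr_ge0 ?(ltW s0).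
have : 0 <= k%:R * s by rewrite !mulr_ge0 ?(ltW s0).
rewrite -ys; lra.
Qed.

End Oscillation.

(* Weighting the n-th difference by (s)_n / n!, s = Re w, and by (w)_n / n!
   gives two series whose terms are comparable; the first one is bounded, and
   the second one contains the divergent resonant part sum_k 1 / (w + k). *)
Lemma complex_roots_not_cm (R : realType) (c be : R) (w : R[i]) :
  0 < c -> 0 < complex.Re w -> complex.Re w < be -> complex.Im w != 0 ->
  ~ forall n, 0 <= dlt (fun k => c / ((k%:R + be) *
      ((k%:R + complex.Re w) ^+ 2 + complex.Im w ^+ 2))) n 0.
Proof.
set s := complex.Re w; set y := complex.Im w => c0 s0 sb y0.
set a := (X in dlt X) => D0.
pose sC := toC s; pose bC := toC be.
have shift0 (v : R[i]) : 0 < complex.Re v -> forall j : nat, v + j%:R != 0.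
  by move=> v0 j; apply: Re_gt0_neq0; rewrite Re_shift ltr_wpDr.
have b0 : 0 < be by exact: lt_trans sb.
have Rewc : complex.Re w^* = s by rewrite Re_conj.
have Imwc : complex.Im w^* = - y by rewrite /y; case: (w).
have w0 := shift0 w s0; have wc0 : forall j, w^* + j%:R != 0.
  by apply: shift0; rewrite Rewc.
have sC0 := shift0 sC s0; have bC0 := shift0 bC b0.
have neqRe (u v : R[i]) : complex.Re u != complex.Re v -> u != v.
  by apply: contraNneq => ->.
have neqIm (u v : R[i]) : complex.Im u != complex.Im v -> u != v.
  by apply: contraNneq => ->.
have bs : bC != sC by apply: neqRe; rewrite gt_eqF.
have bw : bC != w by apply: neqRe; rewrite gt_eqF.
have bwc : bC != w^* by apply: neqRe; rewrite Rewc gt_eqF.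
have ws : w != sC by apply: neqIm.
have wcs : w^* != sC by apply: neqIm; rewrite Imwc oppr_eq0.
have wcw : w^* != w by apply: neqIm; rewrite Imwc -/y eqNr.
(* Partial fraction coefficients of [a] at -be, -w and -conj(w). What matters is B <> 0, as B
   multiplies the divergent series. *)
pose A := toC c / ((w - bC) * (w^* - bC)).
pose B := toC c / ((bC - w) * (w^* - w)).
pose B' := toC c / ((bC - w^*) * (w - w^*)).
have B0 : B != 0.
  by rewrite !mulf_neq0 ?invr_eq0 ?mulf_neq0 ?subr_eq0// eq_complex /= gt_eqF.
pose q (v : R[i]) n := dlt (fun k => (k%:R + v)^-1) n 0.
have aE k : toC (a k) = A * (k%:R + bC)^-1 + (B * (k%:R + w)^-1
    + B' * (k%:R + w^*)^-1).
  have -> : toC (a k) = toC c / ((k%:R + bC) * ((k%:R + w) * (k%:R + w^*))).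
    rewrite /a rmorphM fmorphV rmorphM /= [in RHS]addrC; congr (_ / (_ * _)).
      by rewrite rmorphD /= rmorph_nat addrC.
    have -> : k%:R + w^* = (k%:R + w)^* by rewrite rmorphD /= rmorph_nat.
    by rewrite -normCK [k%:R + w]addrC norm_shift_sq [s + _]addrC.
  have := w0 k; have := wc0 k; have := bC0 k; rewrite ![_ + k%:R]addrC.
  rewrite /A /B /B'; move: bw bwc wcw.
  rewrite -(subr_eq0 bC w) -(subr_eq0 bC w^*) -(subr_eq0 w^* w).
  move=> h1 h2 h3 h4 h5 h6.
  have key (m g b z v : R[i]) : b - v != 0 -> b - z != 0 -> z - v != 0 ->
      m + b != 0 -> m + z != 0 -> m + v != 0 ->
      g / ((m + b) * ((m + v) * (m + z))) =
      g / ((v - b) * (z - b)) / (m + b) + (g / ((b - v) * (z - v)) / (m + v) +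
        g / ((b - z) * (v - z)) / (m + z)).
    move=> e1 e2 e3 e4 e5 e6; field.
    rewrite e1 e2 e3 e4 e5 e6 -(opprB b z) -(opprB b v) -(opprB z v) !oppr_eq0.
    by rewrite e1 e2 e3.
  exact: key.
have dE n : toC (dlt a n 0) = A * q bC n + (B * q w n + B' * q w^* n).
  by rewrite -(dlt_raddf toC) (eq_dlt _ _ aE) !dltD !dltZ.
pose S u M := \sum_(n < M) ratio_prod u 1 n * toC (dlt a n 0).
have SE u M : S u M = A * (\sum_(n < M) ratio_prod u bC n / (bC + n%:R)) +
    (B * (\sum_(n < M) ratio_prod u w n / (w + n%:R)) +
    B' * (\sum_(n < M) ratio_prod u w^* n / (w^* + n%:R))).
  rewrite !mulr_sumr -!big_split; apply: eq_bigr => n _ /=.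
  rewrite dE -!ratio_prod_recip// -/(q _ _) -/(q _ _) -/(q _ _) !mulrDr.
  by rewrite ![ratio_prod u 1 n * _]mulrCA.
have le_norm_w (j : nat) : `|sC + j%:R| <= `|w + j%:R|.
  rewrite -(ler_pXn2r (n := 2)) ?nnegrE ?normr_ge0// !norm_shift_sq lecR /=.
  by rewrite lerD2l expr0n sqr_ge0.
have norm_wc (j : nat) : `|w^* + j%:R| = `|w + j%:R|.
  by rewrite -[RHS]norm_conjC rmorphD /= rmorph_nat.
have le_norm_b (j : nat) : `|sC + j%:R| <= `|bC + j%:R|.
  rewrite -(ler_pXn2r (n := 2)) ?nnegrE ?normr_ge0// !norm_shift_sq lecR /=.
  rewrite lerD2r ler_pXn2r ?nnegrE ?addr_ge0 ?(ltW s0) ?(ltW b0)//.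
  by rewrite lerD2r ltW.
have [K K0 hK] := ratio_prod_bound s0.
have term_le (t M v x : R[i]) : `|t| <= x ->
     `|v * ((1 - t) / M)| <= `|v| / `|M| * (1 + x).
  move=> tx; rewrite !normrM normfV -mulrA ler_wpM2l ?normr_ge0//.
  rewrite mulrC ler_wpM2l ?invr_ge0 ?normr_ge0//.
  by rewrite (le_trans (ler_normB _ _))// normr1 lerD2l.
pose C1 := `|A| / `|bC - sC| * (1 + 1) + (`|B| / `|w - sC| * (1 + 1) +
  `|B'| / `|w^* - sC| * (1 + 1)).
have S1 M : `|S sC M| <= C1.
  rewrite SE !ratio_prod_telescope//.
  rewrite (le_trans (ler_normD _ _))// lerD ?term_le ?ratio_prod_le1//.
  rewrite (le_trans (ler_normD _ _))// lerD ?term_le ?ratio_prod_le1//.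
  by move=> j; rewrite norm_wc.
have rs0 n : 0 <= ratio_prod sC 1 n.
  apply: prodr_ge0 => j _.
  rewrite -(rmorph_nat toC) -(rmorph1 toC) -!rmorphD -fmorphV -rmorphM ler0c.
  by rewrite divr_ge0 ?addr_ge0// ltW.
(* The weights satisfy |(w)_n / n!| <= K (s)_n / n!. As the differences are nonnegative, the sum of
   moduli for [w] is at most K times [S sC M], which has no cancellation and a bounded closed
   form. *)
have Sw M : `|S w M| <= toC K * C1.
  apply: le_trans (ler_norm_sum _ _ _) _.
  apply: (@le_trans _ _ (toC K * S sC M)).
    rewrite mulr_sumr; apply: ler_sum => n _.
    rewrite normrM (@ratio_prodM _ _ sC)// normrM (ger0_norm (rs0 n)).
    rewrite (@ger0_norm _ (toC _)) ?ler0c ?D0// -mulrA.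
    by rewrite ler_wpM2r ?hK// mulr_ge0 ?rs0// ler0c D0.
  rewrite ler_wpM2l ?ler0c// (le_trans _ (S1 M))// real_ler_norm//.
  by rewrite ger0_real// sumr_ge0// => n _; rewrite mulr_ge0 ?rs0// ler0c D0.
pose C2 := toC K * C1 + `|A| / `|bC - w| * (1 + toC K) +
  `|B'| / `|w^* - w| * (1 + 1).
have bound M : `|\sum_(n < M) (w + n%:R)^-1| <= C2 / `|B|.
  rewrite ler_pdivlMr ?normr_gt0// mulrC -normrM.
  have -> : B * (\sum_(n < M) (w + n%:R)^-1) = S w M
     - A * ((1 - ratio_prod w bC M) / (bC - w))
     - B' * ((1 - ratio_prod w w^* M) / (w^* - w)).
    rewrite SE (@ratio_prod_telescope _ w bC)// (@ratio_prod_telescope _ w w^*)//.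
    have -> : \sum_(n < M) ratio_prod w w n / (w + n%:R) =
        \sum_(n < M) (w + n%:R)^-1.
      apply: eq_bigr => n _; rewrite /ratio_prod big1 ?mul1r// => j _.
      by rewrite divff.
    by ring.
  rewrite (le_trans (ler_normB _ _))// lerD//; last first.
    by rewrite term_le// ratio_prod_le1// => j; rewrite norm_wc.
  rewrite (le_trans (ler_normB _ _))// lerD// term_le//.
  rewrite (@ratio_prodM _ _ sC)// normrM -[leRHS]mulr1 ler_pM ?normr_ge0//.
  exact: ratio_prod_le1.
have C20 : 0 <= C2 / `|B| by exact: le_trans (normr_ge0 _) (bound 0%N).
have [M] := @sum_shift_recip_unbounded R w (complex.Re (C2 / `|B|)) s0.
by apply; rewrite RRe_real ?ger0_real// bound.
Qed.

(** * The module and its monomials *)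

Section Kernel.
Variables (R : realType) (s1 s2 : R).
Hypotheses (s1_gt0 : 0 < s1) (s2_gt0 : 0 < s2).
Local Notation C := R[i].

(** At x = n, the coefficient of x^n in the product kernel: the factors are the series of (s n + 1)
    x^n, and the sum of k (n - k) over k <= n is (n-1) n (n+1) / 6. *)
Definition growth (x : R) : R :=
  (x + 1) * (s1 * s2 / 6 * (x * (x - 1)) + (s1 + s2) / 2 * x + 1).
Local Notation P n := (toC (growth n%:R) : C).

Lemma growth_ge1 (n : nat) : 1 <= growth n%:R.
Proof.
have n0 := ler0n R n.
have h : 0 <= n%:R * (n%:R - 1) :> R.
  case: n n0 => [|n] _; first by rewrite mul0r.
  by rewrite -natr1 addrK mulr_ge0.
have a0 : 0 <= s1 * s2 / 6 by rewrite !mulr_ge0 ?invr_ge0 ?ler0n// ltW.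
have b0 : 0 <= (s1 + s2) / 2 by rewrite mulr_ge0 ?invr_ge0 ?ler0n// addr_ge0 ?ltW.
have h1 := mulr_ge0 a0 h; have h2 := mulr_ge0 b0 n0.
by rewrite -[leLHS]mulr1 ler_pM//; lra.
Qed.

Lemma growth_gt0 (n : nat) : 0 < growth n%:R.
Proof. exact: lt_le_trans ltr01 (growth_ge1 n). Qed.

Lemma growthS (n : nat) : growth n%:R <= growth n.+1%:R.
Proof.
have n0 := ler0n R n; have a0 : 0 <= s1 * s2 by rewrite mulr_ge0 ?ltW.
have b0 : 0 <= s1 + s2 by rewrite addr_ge0 ?ltW.
have h1 := mulr_ge0 a0 n0; have h2 := mulr_ge0 h1 n0; have h3 := mulr_ge0 b0 n0.
rewrite -subr_ge0 -natr1 /growth; lra.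
Qed.

Lemma growth_le (n : nat) :
  growth n%:R <= (s1 * s2 + (s1 + s2) + 1) * (n%:R + 1) ^+ 3.
Proof.
have n0 := ler0n R n; have a0 : 0 <= s1 * s2 by rewrite mulr_ge0 ?ltW.
have b0 : 0 <= s1 + s2 by rewrite addr_ge0 ?ltW.
have h1 := mulr_ge0 a0 n0; have h2 := mulr_ge0 h1 n0; have h3 := mulr_ge0 b0 n0.
have h4 := mulr_ge0 h3 n0; have h5 := mulr_ge0 n0 n0.
by rewrite /growth exprS [leRHS]mulrCA ler_wpM2l ?addr_ge0//; lra.
Qed.

Definition tail_num n (x : C) : C :=
  P n + (P n.+1 - 4 * P n) * x + (P n.+2 - 4 * P n.+1 + 6 * P n) * x ^+ 2 +
  (P n.+3 - 4 * P n.+2 + 6 * P n.+1 - 4 * P n) * x ^+ 3.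

(* sum_(j >= n) (growth j) x^(j - n): the fourth differences of the cubic
   growth vanish. *)
Definition tail n (x : C) : C := tail_num n x / (1 - x) ^+ 4.

Lemma tailS n x : x != 1 -> tail n x = P n + x * tail n.+1 x.
Proof.
move=> x1; have x10 : 1 - x != 0 by rewrite subr_eq0 eq_sym.
rewrite /tail; suff -> : tail_num n x = P n * (1 - x) ^+ 4 + x * tail_num n.+1 x.
  by field.
rewrite /tail_num; have -> : P n.+4 = 4 * P n.+3 - 6 * P n.+2 + 4 * P n.+1 - P n.
  rewrite -[4]/(4%:R) -[6]/(6%:R) -!(rmorph_nat toC) -!rmorphM -!(rmorphB, rmorphD).
  by congr toC; rewrite /growth -!natr1; field.
by ring.
Qed.

(** Taylor expansion with exact remainder: an identity of rational functions for n = 0, after which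
    [tailS] peels off one term at a time. *)
Lemma kernelE (x : C) n : x != 1 ->
  (toC s1 / (1 - x) ^+ 2 + toC (1 - s1) / (1 - x)) *
  (toC s2 / (1 - x) ^+ 2 + toC (1 - s2) / (1 - x)) =
  \sum_(j < n) P j * x ^+ j + x ^+ n * tail n x.
Proof.
move=> x1; elim: n => [|n IH]; last first.
  by rewrite IH big_ord_recr /= (tailS n x1) exprSr; ring.
have x10 : 1 - x != 0 by rewrite subr_eq0 eq_sym.
rewrite big_ord0 expr0 mul1r add0r /tail /tail_num /growth.
rewrite !(rmorphM, rmorphD, rmorphB, fmorphV, rmorph_nat, rmorph1).
by field.
Qed.

End Kernel.

Section KernelTail.
Variables (R : realType) (s1 s2 : R).
Hypotheses (s1_gt0 : 0 < s1) (s2_gt0 : 0 < s2).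
Local Notation C := R[i].
Local Notation growth := (growth s1 s2).
Local Notation tail := (tail s1 s2).
Local Notation tail_num := (tail_num s1 s2).
Local Notation P n := (toC (growth n%:R) : C).

Lemma tail_le n (x : C) (r : R) : `|x| <= toC r -> r < 1 ->
  `|tail n x| <= toC (32 * growth n.+3%:R / (1 - r) ^+ 4).
Proof.
move=> xr r1; have r0 : 0 <= r by rewrite -ler0c (le_trans _ xr).
have r10 : 0 < 1 - r by rewrite subr_gt0.
have x1 : `|x| <= 1 by rewrite (le_trans xr)// lecR ltW.
have normP m : `|P m| = P m by rewrite ger0_norm// ler0c ltW// growth_gt0.
have P0 m : 0 <= P m by rewrite ler0c ltW// growth_gt0.
have PS m : P m <= P m.+1 by rewrite lecR growthS.
have PS1 := PS n.+2; have PS2 := le_trans (PS n.+1) PS1.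
have PS3 := le_trans (PS n) PS2.
have nat_norm (m : nat) (y : C) : `|m%:R * y| = m%:R * `|y|.
  by rewrite normrM normr_nat.
have term (a : C) m (k : nat) : `|a| <= k%:R * P n.+3 ->
    `|a * x ^+ m| <= k%:R * P n.+3.
  move=> ha; rewrite normrM normrX -[leRHS]mulr1 ler_pM ?exprn_ge0//.
  by rewrite exprn_ile1.
have num : `|tail_num n x| <= 32 * P n.+3.
  (* The four coefficients of [tail_num] are bounded by 1, 1+4, 1+4+6 and 1+4+6+4 times the largest
     value [P n.+3]. *)
  have -> : 32 * P n.+3 = 1 * P n.+3 + 5 * P n.+3 + 11 * P n.+3 + 15 * P n.+3.
    by ring.
  apply: le_trans (ler_normD _ _) _; apply: lerD; last first.
    apply: (term _ 3 15); apply: le_trans (ler_normB _ _) _.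
    rewrite (_ : 15 * P n.+3 = 11 * P n.+3 + 4 * P n.+3); last by ring.
    apply: lerD; last by rewrite nat_norm normP ler_wpM2l.
    apply: le_trans (ler_normD _ _) _.
    rewrite (_ : 11 * P n.+3 = 5 * P n.+3 + 6 * P n.+3); last by ring.
    apply: lerD; last by rewrite nat_norm normP ler_wpM2l.
    apply: le_trans (ler_normB _ _) _.
    rewrite (_ : 5 * P n.+3 = 1 * P n.+3 + 4 * P n.+3); last by ring.
    apply: lerD; first by rewrite normP mul1r.
    by rewrite nat_norm normP ler_wpM2l.
  apply: le_trans (ler_normD _ _) _; apply: lerD; last first.
    apply: (term _ 2 11); apply: le_trans (ler_normD _ _) _.
    rewrite (_ : 11 * P n.+3 = 5 * P n.+3 + 6 * P n.+3); last by ring.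
    apply: lerD; last by rewrite nat_norm normP ler_wpM2l.
    apply: le_trans (ler_normB _ _) _.
    rewrite (_ : 5 * P n.+3 = 1 * P n.+3 + 4 * P n.+3); last by ring.
    apply: lerD; first by rewrite normP mul1r.
    by rewrite nat_norm normP ler_wpM2l.
  apply: le_trans (ler_normD _ _) _; apply: lerD; first by rewrite normP mul1r.
  apply: (term _ 1 5); apply: le_trans (ler_normB _ _) _.
  rewrite (_ : 5 * P n.+3 = 1 * P n.+3 + 4 * P n.+3); last by ring.
  apply: lerD; first by rewrite normP mul1r.
  by rewrite nat_norm normP ler_wpM2l.
rewrite /tail normrM normfV normrX rmorphM fmorphV rmorphXn rmorphM rmorph_nat /=.
have den : toC (1 - r) <= `|1 - x|.
  rewrite rmorphB rmorph1 /=; apply: le_trans (lerB_dist _ _).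
  by rewrite normr1 lerD2l lerN2.
have den0 : 0 < toC (1 - r) by rewrite ltcR.
rewrite ler_pM ?invr_ge0 ?exprn_ge0//.
rewrite lef_pV2 ?posrE ?exprn_gt0 ?(lt_le_trans den0)//.
by rewrite lerXn2r ?nnegrE ?(ltW den0).
Qed.

Lemma tail_near n : exists2 c : R, 0 <= c &
  forall x : C, `|x| <= toC 2^-1 -> `|tail n x - P n| <= toC c * `|x|.
Proof.
have h1 : 2^-1 < 1 :> R by lra.
exists (32 * growth n.+4%:R / (1 - 2^-1) ^+ 4).
  apply: divr_ge0; first by rewrite mulr_ge0// ltW// growth_gt0.
  by apply: exprn_ge0; lra.
move=> x x2; rewrite tailS; last first.
  by apply: contraTneq x2 => ->; rewrite normr1 -(rmorph1 toC) lecR -ltNge.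
by rewrite addrC addKr normrM mulrC ler_wpM2r// tail_le.
Qed.

(** Take the fourth power of (n+1) q^n (1-q) <= 1 for the fourth root q of r. Exponent 4 leaves one
    factor n+1 to spare over the cubic [growth]. *)
Lemma pow_geometric_bound (r : R) : 0 <= r -> r < 1 ->
  exists2 c : R, 0 < c & forall n, n.+1%:R ^+ 4 * r ^+ n <= c.
Proof.
move=> r0 r1; pose q := Num.sqrt (Num.sqrt r).
have q0 : 0 <= q by exact: sqrtr_ge0.
have q4 : q ^+ 4 = r by rewrite (exprM q 2 2) !sqr_sqrtr ?sqrtr_ge0.
have q1 : q < 1.
  by rewrite ltNge; apply/negP => h; move: r1; rewrite -q4 ltNge exprn_ege1.
have lin n : n.+1%:R * q ^+ n * (1 - q) <= 1 - q ^+ n.+1.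
  elim: n => [|n IH]; first by rewrite expr0 expr1 !mul1r.
  have qn : 0 <= q ^+ n.+1 <= 1 by rewrite exprn_ge0// exprn_ile1// ltW.
  have := ler_wpM2l q0 IH; rewrite [q ^+ n.+2]exprS -[n.+2%:R]natr1.
  have -> : q * (n.+1%:R * q ^+ n * (1 - q)) = n.+1%:R * q ^+ n.+1 * (1 - q).
    by rewrite exprS; ring.
  have q1' : 0 <= 1 - q by rewrite subr_ge0 ltW.
  have p1' : 0 <= 1 - q ^+ n.+1 by rewrite subr_ge0; case/andP: qn.
  have := mulr_ge0 q1' p1'; move: (q ^+ n.+1) (n.+1%:R) => p t; lra.
have p1 : 0 < 1 - q by rewrite subr_gt0.
exists ((1 - q)^-1 ^+ 4) => [|n]; first by rewrite exprn_gt0// invr_gt0.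
rewrite -q4 -exprM mulnC exprM -exprMn lerXn2r ?nnegrE ?invr_ge0 ?(ltW p1)//.
  by rewrite mulr_ge0// exprn_ge0.
rewrite -[leRHS]mul1r ler_pdivlMr//; apply: le_trans (lin n) _.
by rewrite gerBl exprn_ge0.
Qed.

Lemma tail_small (r e : R) : 0 <= r -> r < 1 -> 0 < e ->
  exists n, r ^+ n * (32 * growth n.+3%:R / (1 - r) ^+ 4) < e.
Proof.
move=> r0 r1 e0; have [c c0 hc] := pow_geometric_bound r0 r1.
pose a := s1 * s2 + (s1 + s2) + 1.
have a0 : 0 < a by rewrite ltr_wpDl// ltW// addr_gt0 ?mulr_gt0 ?addr_gt0.
have p0 : 0 < (1 - r) ^+ 4 by rewrite exprn_gt0// subr_gt0.
pose k := 32 * (a * 64) / (1 - r) ^+ 4.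
have k0 : 0 < k by rewrite divr_gt0// !mulr_gt0.
exists (Num.truncn (k * c / e)); set n := Num.truncn _.
have hn : k * c < n.+1%:R * e by rewrite -ltr_pdivrMr// truncnS_gt.
have n0 : 0 < n.+1%:R :> R by rewrite ltr0n.
rewrite -(ltr_pM2l n0); apply: le_lt_trans hn.
have : growth n.+3%:R <= a * (64 * n.+1%:R ^+ 3).
  apply: le_trans (growth_le s1_gt0 s2_gt0 _) _; rewrite -/a ler_wpM2l ?(ltW a0)//.
  rewrite (_ : 64 = 4 ^+ 3 :> R); last by rewrite -natrX.
  have h4 : n.+3%:R + 1 <= 4 * n.+1%:R :> R.
    by rewrite natr1 -natrM ler_nat; lia.
  rewrite -exprMn; apply: lerXn2r h4; rewrite nnegrE.
    exact: addr_ge0 (ler0n _ _) ler01.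
  by rewrite mulr_ge0.
move=> hg; apply: (@le_trans _ _ (n.+1%:R * (r ^+ n *
    (32 * (a * (64 * n.+1%:R ^+ 3)) / (1 - r) ^+ 4)))).
  rewrite ler_wpM2l ?(ltW n0)// ler_wpM2l ?exprn_ge0//.
  by rewrite ler_wpM2r ?invr_ge0 ?(ltW p0)// ler_wpM2l.
have -> : n.+1%:R * (r ^+ n * (32 * (a * (64 * n.+1%:R ^+ 3)) / (1 - r) ^+ 4)) =
    k * (n.+1%:R ^+ 4 * r ^+ n) by rewrite /k; ring.
by rewrite ler_wpM2l ?(ltW k0).
Qed.

End KernelTail.

(** * Construction of the monomials as limits of kernel functions *)

Section ComplexSequences.
Variable R : realType.
Local Notation C := R[i].

Definition ccvg (a : nat -> C) (c : C) := forall e : R, 0 < e ->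
  exists N, forall n, (N <= n)%N -> `|a n - c| <= toC e.

Lemma ccvg_unique (a : nat -> C) (c c' : C) : ccvg a c -> ccvg a c' -> c = c'.
Proof.
move=> ac ac'; apply/eqP; rewrite -subr_eq0 -normr_eq0.
have [r r0 rE] : exists2 r : R, 0 <= r & `|c - c'| = toC r.
  exists (complex.Re `|c - c'|); last by rewrite RRe_real ?normr_real.
  by rewrite -ler0c RRe_real ?normr_real.
rewrite rE; suff : r <= 0 by move=> r1; rewrite (@le_anti _ _ r 0) ?r0 ?r1.
apply/ler_addgt0Pr => e e0; rewrite add0r.
have e2 : 0 < e / 2 by rewrite divr_gt0.
have [N hN] := ac _ e2; have [M hM] := ac' _ e2.
rewrite -lecR -rE -(subrK (a (maxn N M)) c) -addrA.
apply: le_trans (ler_normD _ _) _; rewrite distrC [e]splitr rmorphD /=.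
by rewrite lerD ?hN ?hM ?leq_maxl ?leq_maxr.
Qed.

Lemma hcvg_dot (H : hilbert R) (u : nat -> H) (l v : H) :
  hcvg u l -> ccvg (fun n => hdot H (u n) v) (hdot H l v).
Proof.
move=> ul e e0; have v0 := nsq_ge0 v.
have [|N hN] := ul (e ^+ 2 / (nsq v + 1)).
  by rewrite divr_gt0 ?exprn_gt0// ltr_wpDl.
exists N => n /hN h; rewrite -dotBl.
rewrite -(ler_pXn2r (n := 2)) ?nnegrE ?normr_ge0 ?ler0c ?(ltW e0)//.
apply: le_trans (CS _ _) _; rewrite -(rmorphXn toC) lecR.
apply: (@le_trans _ _ (e ^+ 2 / (nsq v + 1) * (nsq v + 1))).
  by rewrite ler_pM ?nsq_ge0 ?(ltW h)// lerDl.
by rewrite divfK// gt_eqF// ltr_wpDl.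
Qed.

End ComplexSequences.

Lemma nsq_subE (R : realType) (H : hilbert R) (u v : H) :
  toC (nsq (u - v)) =
  hdot H u u - hdot H u v - (hdot H v u - hdot H v v).
Proof. by rewrite -nsqE dotBl !dotBr. Qed.

Local Opaque growth tail.

Section Monomials.
Variables (R : realType) (s1 s2 : R).
Hypotheses (s1_gt0 : 0 < s1) (s2_gt0 : 0 < s2).
Variable H : module_tensor (bergman_kernel s1) (bergman_kernel s2).
Local Notation C := R[i].
Local Notation growth := (growth s1 s2).
Local Notation tail := (tail s1 s2).
Local Notation P n := (toC (growth n%:R) : C).
Local Notation dot := (hdot H).
Implicit Types (z w : disc R) (f g : H).

Lemma P_neq0 n : P n != 0.
Proof. by rewrite (@fmorph_eq0 _ _ toC) gt_eqF// growth_gt0. Qed.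

Lemma conj_P n : (P n)^* = P n.
Proof. exact: conj_toC. Qed.

Lemma disc_mul_lt1 z w : `|\val z * (\val w)^*| < 1.
Proof.
rewrite normrM norm_conjC -[ltRHS]mulr1.
by apply: ltr_pM => //; [exact: (valP z)|exact: (valP w)].
Qed.

Lemma rk_pointE_tail n z w : rk_eval (rk_point H w) z =
  \sum_(j < n) P j * (\val z * (\val w)^*) ^+ j +
  (\val z * (\val w)^*) ^+ n * tail n (\val z * (\val w)^*).
Proof.
rewrite rk_pointE -kernelE//.
by apply: contraTneq (disc_mul_lt1 z w) => ->; rewrite normr1 ltxx.
Qed.

Lemma rk_evalE f w : dot f (rk_point H w) = rk_eval f w.
Proof. by rewrite rk_reproducing. Qed.

Lemma monomial_unique n f g : is_monomial n f -> is_monomial n g -> f = g.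
Proof.
by move=> fn gn; apply: (@rk_eval_inj _ _ _ H); apply/funext => z; rewrite fn gn.
Qed.

Definition monomials_upto n (m : nat -> H) :=
  (forall j, (j < n)%N -> is_monomial j (m j)) /\
  (forall i j, (i < n)%N -> (j < n)%N -> dot (m i) (m j) = (i == j)%:R * (P i)^-1).

(** The part of k(., w) orthogonal to the first [n] monomials: its Fourier coefficient along z^j is
    conj(w)^j / |z^j|^2, and |z^j|^2 = 1 / P j. *)
Definition kernel_rest n (m : nat -> H) w : H :=
  rk_point H w - \sum_(j < n) (P j * (\val w)^* ^+ j) *: m j.

Section KernelRest.
Variables (n : nat) (m : nat -> H).
Hypothesis mP : monomials_upto n m.

Lemma dot_kernel_rest f w : dot f (kernel_rest n m w) =
  rk_eval f w - \sum_(j < n) P j * \val w ^+ j * dot f (m j).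
Proof.
rewrite dotBr rk_evalE dot_sumr; congr (_ - _); apply: eq_bigr => j _.
by rewrite dotZr rmorphM rmorphXn /= conjCK conj_P.
Qed.

Lemma dot_monomial_rest i w : (i < n)%N -> dot (m i) (kernel_rest n m w) = 0.
Proof.
move=> lin; have [mon orth] := mP.
rewrite dot_kernel_rest mon// (bigD1 (Ordinal lin))//= orth// eqxx mul1r.
rewrite mulrAC divff ?P_neq0// mul1r big1 ?addr0 ?subrr// => j ji.
rewrite orth// (_ : (i == j :> nat) = false) ?mul0r ?mulr0//.
by apply/negbTE; rewrite eq_sym; exact: ji.
Qed.

Lemma rk_eval_rest z w : rk_eval (kernel_rest n m w) z =
  (\val z * (\val w)^*) ^+ n * tail n (\val z * (\val w)^*).
Proof.
have [mon orth] := mP.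
rewrite -rk_evalE dotBl rk_evalE (rk_pointE_tail n) dot_suml.
set S := \sum_(j < n) _; set S' := \sum_(j < n) _.
suff -> : S' = S by rewrite addrAC subrr add0r.
apply: eq_bigr => j _; rewrite dotZl rk_evalE mon// exprMn.
by rewrite -mulrA [(\val w)^* ^+ j * _]mulrC.
Qed.

Lemma dot_rest_rest z w : dot (kernel_rest n m z) (kernel_rest n m w) =
  (\val w * (\val z)^*) ^+ n * tail n (\val w * (\val z)^*).
Proof.
rewrite dot_kernel_rest rk_eval_rest big1 ?subr0// => j _.
by rewrite dotC dot_monomial_rest ?conjC0 ?mulr0.
Qed.

(** Real points of the disc tending to 0; the offset 2 keeps them within 1/2, as [tail_near]
    requires. *)
Let eps k : R := k.+2%:R^-1.

Let eps_gt0 k : 0 < eps k.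
Proof. by rewrite invr_gt0. Qed.

Let eps_le k : eps k <= 2^-1.
Proof. by rewrite lef_pV2 ?posrE ?ltr0n// ler_nat. Qed.

Let point_subproof k : `|toC (eps k) : C| < 1.
Proof.
rewrite ger0_norm ?ler0c ?(ltW (eps_gt0 k))// -(rmorph1 toC) ltcR.
by rewrite (le_lt_trans (eps_le k))// invf_lt1 ?ltr1n.
Qed.

Let point k : disc R := exist _ (toC (eps k)) (point_subproof k).

(** As a function this is z^n tail n (eps z), which tends to P n z^n. *)
Let approx k : H := toC (eps k ^- n) *: kernel_rest n m (point k).

Let epsC_neq0 k : toC (eps k) != 0 :> C.
Proof. by rewrite (@fmorph_eq0 _ _ toC) gt_eqF. Qed.

Let scaleE k : toC (eps k ^- n) = (toC (eps k) ^+ n)^-1 :> C.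
Proof. by rewrite fmorphV rmorphXn. Qed.

Let eval_approx z k : dot (approx k) (rk_point H z) =
  \val z ^+ n * tail n (\val z * toC (eps k)).
Proof.
rewrite dotZl rk_evalE rk_eval_rest /= conj_toC exprMn [\val z ^+ n * _]mulrC.
by rewrite scaleE !mulrA mulVf ?expf_neq0// mul1r.
Qed.

Let dot_approx k l : dot (approx k) (approx l) =
  tail n (toC (eps k) * toC (eps l)).
Proof.
rewrite dotZl dotZr dot_rest_rest /= !conj_toC !scaleE exprMn.
rewrite [toC (eps l) * toC (eps k)]mulrC.
have := expf_neq0 n (epsC_neq0 k); have := expf_neq0 n (epsC_neq0 l).
move: (_ ^+ n) (_ ^+ n) (tail _ _) => a b t a0 b0.
by field; rewrite a0 b0.
Qed.

Let dot_monomial_approx i k : (i < n)%N -> dot (m i) (approx k) = 0.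
Proof. by move=> lin; rewrite dotZr dot_monomial_rest// mulr0. Qed.

Let approx_spec : exists u : nat -> H,
  [/\ forall z k, dot (u k) (rk_point H z) =
         \val z ^+ n * tail n (\val z * toC (eps k)),
       forall k l, dot (u k) (u l) = tail n (toC (eps k) * toC (eps l)) &
       forall i k, (i < n)%N -> dot (m i) (u k) = 0].
Proof. by exists approx; split. Qed.

Let tail_cvg (a : C) : `|a| <= 1 ->
  ccvg (fun k => tail n (a * toC (eps k))) (P n).
Proof.
move=> a1 e e0; have [c c0 hc] := tail_near s1_gt0 s2_gt0 n.
have [|N hN] := @inv_nat_small R (e / (c + 1)).
  by rewrite divr_gt0// ltr_wpDl.
exists N => k Nk.
have ek : `|toC (eps k) : C| = toC (eps k) by rewrite ger0_norm// ler0c ltW.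
have ak : `|a * toC (eps k)| <= toC (eps k).
  by rewrite normrM ek ler_piMl// ler0c ltW.
apply: le_trans (hc _ _) _; first by rewrite (le_trans ak)// lecR.
apply: (@le_trans _ _ (toC c * toC (eps k))).
  by rewrite ler_wpM2l// ler0c.
rewrite -(rmorphM toC) lecR; apply: (@le_trans _ _ ((c + 1) * eps k)).
  by rewrite ler_wpM2r ?lerDl// ltW.
rewrite mulrC -ler_pdivlMr ?ltr_wpDl//; apply/ltW/hN.
exact: leqW Nk.
Qed.

(** The Gram entries all tend to the same number P n, and |u k - u l|^2 is a signed sum of four of
    them in which P n cancels. *)
Let approx_cvg (u : nat -> H) :
  (forall k l, dot (u k) (u l) = tail n (toC (eps k) * toC (eps l))) ->
  exists l, hcvg u l.
Proof.
move=> dot_u; apply: hcomplete => e e0.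
have [c c0 hc] := tail_near s1_gt0 s2_gt0 n.
have [|N hN] := @inv_nat_small R (e / (4 * (c + 1))).
  by rewrite divr_gt0// mulr_gt0// ltr_wpDl.
exists N => k l Nk Nl.
pose t i j : C := tail n (toC (eps i) * toC (eps j)) - P n.
have tE i j : (N <= i)%N -> `|t i j| <= toC (c * eps i).
  move=> Ni; have ei : `|toC (eps i) * toC (eps j) : C| <= toC (eps i).
    rewrite -(rmorphM toC) ger0_norm ?ler0c ?mulr_ge0 ?(ltW (eps_gt0 _))// lecR.
    rewrite ler_piMr ?(ltW (eps_gt0 _))// (le_trans (eps_le j))//.
    by rewrite invf_le1 ?ler1n.
  apply: le_trans (hc _ _) _; first by rewrite (le_trans ei)// lecR.
  by rewrite (rmorphM toC) /= ler_wpM2l// ler0c.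
have small i : (N <= i)%N -> c * eps i < e / 4.
  move=> Ni; have ci : c * eps i <= (c + 1) * eps i.
    by rewrite ler_wpM2r ?lerDl// ltW.
  apply: le_lt_trans ci _; have c1 : 0 < c + 1 by rewrite ltr_wpDl.
  rewrite mulrC -ltr_pdivlMr// -mulrA -invfM hN//.
  exact: leqW Ni.
rewrite -ltcR -[toC (nsq _)]ger0_norm ?ler0c ?nsq_ge0//.
have -> : toC (nsq (u k - u l)) = t k k - t k l - (t l k - t l l).
  by rewrite nsq_subE !dot_u /t; ring.
have -> : toC e = toC (e / 4) + toC (e / 4) + (toC (e / 4) + toC (e / 4)).
  by rewrite -!(rmorphD toC); congr toC; field.
have tlt i j : (N <= i)%N -> `|t i j| < toC (e / 4).
  by move=> Ni; apply: le_lt_trans (tE _ _ Ni) _; rewrite ltcR small.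
apply: le_lt_trans (ler_normB _ _) _; apply: ltrD.
  by apply: le_lt_trans (ler_normB _ _) _; apply: ltrD; exact: tlt.
by apply: le_lt_trans (ler_normB _ _) _; apply: ltrD; exact: tlt.
Qed.

Lemma monomials_step : exists m', monomials_upto n.+1 m'.
Proof.
have [u [eval_u dot_u mon_u]] := approx_spec.
have [l al] := approx_cvg dot_u.
have evl z : dot l (rk_point H z) = \val z ^+ n * P n.
  apply: ccvg_unique (hcvg_dot _ al) _ => e e0.
  have z1 : `|\val z| <= 1 by exact: ltW (valP z).
  have [N hN] := tail_cvg z1 e0; exists N => k /hN h.
  rewrite eval_u -mulrBr normrM normrX -[leRHS]mul1r ler_pM ?exprn_ge0//.
  by rewrite exprn_ile1.
have lk k : dot l (u k) = P n.
  apply: ccvg_unique (hcvg_dot _ al) _ => e e0.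
  have ek : `|toC (eps k) : C| <= 1 by rewrite ltW.
  have [N hN] := tail_cvg ek e0; exists N => i /hN.
  by rewrite dot_u mulrC.
have ll : dot l l = P n.
  apply: ccvg_unique (hcvg_dot _ al) _ => e e0; exists 0%N => k _.
  by rewrite dotC lk conj_P subrr normr0 ler0c ltW.
have lm i : (i < n)%N -> dot l (m i) = 0.
  move=> lin; apply: ccvg_unique (hcvg_dot _ al) _ => e e0; exists 0%N => k _.
  by rewrite dotC mon_u// conjC0 subrr normr0 ler0c ltW.
have [mon orth] := mP.
exists (fun j => if (j < n)%N then m j else (P n)^-1 *: l); split.
  move=> j; rewrite ltnS leq_eqVlt => /orP[/eqP->|jn]; last first.
    by rewrite jn; exact: mon.
  move=> z; rewrite ltnn -rk_evalE dotZl evl mulrCA mulVf ?P_neq0// mulr1//.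
have cP : ((P n)^-1)^* = (P n)^-1 by rewrite fmorphV /= conj_P.
move=> i j; rewrite !ltnS leq_eqVlt [(j <= n)%N]leq_eqVlt.
move=> /orP[/eqP->|lin] /orP[/eqP->|ljn].
- rewrite ltnn eqxx dotZl dotZr cP ll mulr1n mul1r.
  by move: (P n) (P_neq0 n) => p p0; rewrite mulVf// mulr1.
- by rewrite ltnn ljn dotZl lm// gtn_eqF// mul0r mulr0.
- by rewrite ltnn lin dotZr dotC lm// ltn_eqF// conjC0 mul0r mulr0.
by rewrite lin ljn orth.
Qed.

End KernelRest.

(** The induction only yields a finite family for each n. A vector is determined by its function, so
    these families agree where they overlap and can be glued. *)
Lemma monomials_exist : exists m : nat -> H,
  (forall n, is_monomial n (m n)) /\
  (forall i j, dot (m i) (m j) = (i == j)%:R * (P i)^-1).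
Proof.
have up n : exists m, monomials_upto n m.
  elim: n => [|n [m hm]]; first by exists (fun=> 0); split.
  exact: monomials_step hm.
have /choice[m hm] : forall n, exists f, is_monomial n f /\
    forall i g, is_monomial i g -> dot f g = (n == i)%:R * (P n)^-1.
  move=> n; have [m [mon orth]] := up n.+1; exists (m n); split; first exact: mon.
  move=> i g gi; have [m' [mon' orth']] := up (maxn n i).+1.
  rewrite (monomial_unique (mon n _) (mon' n _)) ?ltnS ?leq_maxl//.
  rewrite (monomial_unique gi (mon' i _)) ?ltnS ?leq_maxr//.
  by rewrite orth' ?ltnS ?leq_maxl ?leq_maxr.
exists m; split=> [n|i j]; first by case: (hm n).
by have [_] := hm i; apply; case: (hm j).
Qed.

End Monomials.

(** * Density of the monomials *)

Section OrthonormalBasis.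
Variables (R : realType) (H : hilbert R) (e : nat -> H).
Hypothesis e_orth : forall i j, hdot H (e i) (e j) = (i == j)%:R.
Hypothesis e_total : forall v, (forall n, hdot H v (e n) = 0) -> v = 0.

(** Bessel's inequality bounds the squared norms [A n] of the Fourier sums, which are therefore
    Cauchy; their limit has the coefficients of [f], and totality identifies the two. *)
Lemma orthonormal_total_dense : dense e.
Proof.
move=> f eps eps0; pose c n := hdot H f (e n).
pose S n := comb e [seq (c k, k) | k <- iota 0 n].
pose A n : R := \sum_(0 <= k < n) (complex.Re (c k) ^+ 2 + complex.Im (c k) ^+ 2).
have SE n v : hdot H v (S n) = \sum_(0 <= k < n) (c k)^* * hdot H v (e k).
  rewrite /S /comb big_map dot_sumr /index_iota subn0.
  by apply: eq_bigr => k _; rewrite dotZr.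
have Se n k : (k < n)%N -> hdot H (S n) (e k) = c k.
  move=> kn; rewrite dotC SE rmorph_sum (bigD1_seq k) ?mem_index_iota ?iota_uniq//=.
  rewrite e_orth eqxx mulr1 conjCK big1 ?addr0// => j jk.
  by rewrite e_orth eq_sym (negPf jk) mulr0 conjC0.
have AE n : toC (A n) = \sum_(0 <= k < n) (c k)^* * c k.
  rewrite rmorph_sum; apply: eq_bigr => k _.
  by rewrite mulrC -normCK normc_sq.
have dfS n : hdot H f (S n) = toC (A n) by rewrite SE AE.
have dSS n p : (n <= p)%N -> hdot H (S p) (S n) = toC (A n).
  move=> np; rewrite SE AE; apply: eq_big_nat => k /andP[_ kn].
  by rewrite Se// (leq_trans kn).
have nS n : nsq (S n) = A n by rewrite /nsq dSS.
have Ale n : A n <= nsq f.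
  have := nsq_ge0 (f - S n); rewrite nsqB dfS nS /=; lra.
have nSS n p : (n <= p)%N -> nsq (S p - S n) = A p - A n.
  move=> np; rewrite nsqB dSS// !nS /=; lra.
have [a Aa] : exists a, (forall n, A n <= a) /\
    forall d, 0 < d -> exists N, forall n, (N <= n)%N -> a - d < A n.
  have Amono : nondecreasing_seq A.
    by move=> n p np; rewrite -subr_ge0 -nSS// nsq_ge0.
  have Acvg : cvgn A.
    by apply: nondecreasing_is_cvgn => //; exists (nsq f) => _ [n _ <-].
  exists (limn A); split=> [n|d d0]; first exact: nondecreasing_cvgn_le.
  have /cvgrPdist_lt/(_ _ d0)[N _ hN] := Acvg.
  exists N => n /hN /=; have := ler_norm (limn A - A n); lra.
have [Aa1 Aa2] := Aa.
have [d d0|g Sg] := @hcomplete R H S.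
  have [N hN] := Aa2 _ d0; exists N => n p Nn Np.
  wlog np : n p Nn Np / (n <= p)%N.
    by move=> wl; have /orP[/wl|/wl] := leq_total n p; [|rewrite nsqC]; exact.
  by rewrite nsqC nSS//; have := hN _ Nn; have := Aa1 p; lra.
have fg : f = g.
  apply/eqP; rewrite -subr_eq0; apply/eqP/e_total => k.
  rewrite dotBl; apply/eqP; rewrite subr_eq0; apply/eqP.
  apply: ccvg_unique (hcvg_dot (e k) Sg) => d d0; exists k.+1 => n kn.
  by rewrite Se// subrr normr0 ler0c ltW.
have [N hN] := Sg _ eps0; exists [seq (c k, k) | k <- iota 0 N].
by rewrite fg nsqC hN.
Qed.

End OrthonormalBasis.

Section MonomialBasis.
Variables (R : realType) (s1 s2 : R).
Hypotheses (s1_gt0 : 0 < s1) (s2_gt0 : 0 < s2).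
Variable H : module_tensor (bergman_kernel s1) (bergman_kernel s2).
Local Notation C := R[i].
Local Notation growth := (growth s1 s2).
Local Notation tail := (tail s1 s2).
Local Notation P n := (toC (growth n%:R) : C).
Local Notation dot := (hdot H).
Variable m : nat -> H.
Hypothesis mon : forall n, is_monomial n (m n).
Hypothesis orth : forall i j, dot (m i) (m j) = (i == j)%:R * (P i)^-1.

(** For such v the value v(w) is <v, kernel_rest n m w> for every n, and the squared norm of the
    rest is at most |w|^(2n) times a factor of polynomial growth in n. *)
Lemma monomials_total v : (forall n, dot v (m n) = 0) -> v = 0.
Proof.
move=> vm; apply: (@rk_eval_inj _ _ _ H); apply/funext => w.
rewrite -!(@rk_evalE _ _ _ H) dot0l.
pose t : R := complex.Re (\val w) ^+ 2 + complex.Im (\val w) ^+ 2.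
have tE : \val w * (\val w)^* = toC t by rewrite -normCK normc_sq.
have t0 : 0 <= t by rewrite addr_ge0 ?sqr_ge0.
have t1 : t < 1.
  have := disc_mul_lt1 w w; rewrite tE ger0_norm ?ler0c//.
  by rewrite -(rmorph1 toC) ltcR.
set x := dot v _; pose q : R := complex.Re x ^+ 2 + complex.Im x ^+ 2.
have xq : `|x| ^+ 2 = toC q by rewrite normc_sq.
suff : q <= 0.
  move=> q1; apply/eqP; rewrite -normr_eq0 -sqrf_eq0 xq eq_le ler0c lecR q1.
  by rewrite addr_ge0 ?sqr_ge0.
apply/ler_addgt0Pr => e e0; rewrite add0r.
have v1 : 0 < nsq v + 1 by rewrite ltr_wpDl ?nsq_ge0.
have [|n hn] := tail_small s1_gt0 s2_gt0 t0 t1 (e := e / (nsq v + 1)).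
  by rewrite divr_gt0.
have up : monomials_upto n m by split => [j _|i j _ _]; [exact: mon|exact: orth].
have xE : x = dot v (kernel_rest n m w).
  rewrite (@dot_kernel_rest _ _ _ H) big1 ?subr0 => [|j _]; last first.
    by rewrite vm mulr0.
  by rewrite /x (@rk_evalE _ _ _ H).
have := CS v (kernel_rest n m w); rewrite -xE xq lecR => /le_trans; apply.
have rest_le : nsq (kernel_rest n m w) <=
    t ^+ n * (32 * growth n.+3%:R / (1 - t) ^+ 4).
  rewrite -lecR -[toC (nsq _)]ger0_norm ?ler0c ?nsq_ge0// -nsqE.
  rewrite (dot_rest_rest s1_gt0 s2_gt0 up) tE normrM rmorphM rmorphXn /=.
  rewrite normrX ger0_norm ?ler0c// ler_wpM2l ?exprn_ge0 ?ler0c//.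
  by rewrite tail_le// ger0_norm ?ler0c.
apply: (@le_trans _ _ ((nsq v + 1) * (e / (nsq v + 1)))); last first.
  by rewrite mulrCA divff ?mulr1// gt_eqF.
rewrite ler_pM ?nsq_ge0 ?lerDl//.
exact: le_trans rest_le (ltW hn).
Qed.

Definition unit_monomial n : H := toC (Num.sqrt (growth n%:R)) *: m n.

Lemma unit_monomial_orth i j : dot (unit_monomial i) (unit_monomial j) = (i == j)%:R.
Proof.
rewrite dotZl dotZr conj_toC orth; case: eqVneq => [->|_]; last first.
  by rewrite mul0r !mulr0.
have g0 := growth_gt0 s1_gt0 s2_gt0 j.
rewrite mulr1n mul1r mulrA -(rmorphM toC) -expr2 sqr_sqrtr ?ltW//.
by rewrite divff// (@fmorph_eq0 _ _ toC) gt_eqF.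
Qed.

Lemma unit_monomial_dense : dense unit_monomial.
Proof.
apply: orthonormal_total_dense; first exact: unit_monomial_orth.
move=> v hv; apply: monomials_total => n; have := hv n; rewrite dotZr conj_toC.
move=> /eqP; rewrite mulf_eq0 => /orP[|/eqP//].
by rewrite (@fmorph_eq0 _ _ toC) sqrtr_eq0 leNgt growth_gt0.
Qed.

Lemma monomial_dense : dense m.
Proof.
apply: (dense_trans unit_monomial_dense) => n.
by exists [:: (toC (Num.sqrt (growth n%:R)), n)]; rewrite comb1.
Qed.

Lemma nsq_monomial n : nsq (m n) = (growth n%:R)^-1.
Proof.
apply: (@complexI R); rewrite -nsqE orth eqxx mulr1n mul1r.
by rewrite fmorphV.
Qed.

End MonomialBasis.

(** * Multiplication by z and its normal extension *)

Section Module.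
Variables (R : realType) (s1 s2 : R).
Hypotheses (s1_gt0 : 0 < s1) (s2_gt0 : 0 < s2).
Variable H : module_tensor (bergman_kernel s1) (bergman_kernel s2).
Local Notation C := R[i].
Local Notation growth := (growth s1 s2).
Local Notation P n := (toC (growth n%:R) : C).
Local Notation dot := (hdot H).
Variable m : nat -> H.
Hypothesis mon : forall n, is_monomial n (m n).
Hypothesis orth : forall i j, dot (m i) (m j) = (i == j)%:R * (P i)^-1.

Let m_dense : dense m := monomial_dense s1_gt0 s2_gt0 mon orth.

Lemma growthV_le1 (n : nat) : (growth n%:R)^-1 <= 1.
Proof. by rewrite invf_le1 ?growth_ge1 ?growth_gt0. Qed.

(** The Gram matrix of the z^n minus that of the z^(n+1) is diagonal with nonnegative entries,
    because 1 / growth decreases. So the shift is a contraction. *)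
Lemma mulz_exists : exists T : {linear H -> H},
  [/\ is_mulz T, forall n, T (m n) = m n.+1 & forall f, nsq (T f) <= nsq f].
Proof.
have le s : nsq (comb (fun n => m n.+1) s) <= nsq (comb m s).
  pose d (n : nat) := (growth n%:R)^-1 - (growth n.+1%:R)^-1.
  have d0 n : 0 <= d n.
    by rewrite subr_ge0 lef_pV2 ?posrE ?growth_gt0// growthS.
  pose u n : C := toC (Num.sqrt (d n)).
  rewrite -lecR -subr_ge0 !nsq_comb.
  rewrite (@eq_kform _ _ (fun i j => dot (m i) (m j)) (fun i j =>
    dot (m i.+1) (m j.+1) + u i * (u j)^* * (i == j)%:R)); last first.
    move=> i j; rewrite !orth eqSS; case: eqVneq => [->|_]; last first.
      by rewrite !mul0r mulr0 addr0.
    rewrite !mulr1n !mul1r mulr1 /u conj_toC -(rmorphM toC) -expr2.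
    by rewrite sqr_sqrtr// rmorphB !fmorphV /= addrC subrK.
  rewrite kformD addrC addKr kform_diag.
  by have [_] := @psd_eq R nat nat id; apply.
have [T [Tm T1]] := contraction_extension le m_dense.
exists T; split => // f z; apply/eqP; rewrite -subr_eq0; apply/eqP.
rewrite -!(@rk_evalE _ _ _ H).
apply: (@dense_functional_eq0 _ _ _ _ m_dense
  (fun f => dot (T f) (rk_point H z) - \val z * dot f (rk_point H z))
  (4 * nsq (rk_point H z))).
- by move=> a f' g; rewrite linearP !dotDl !dotZl; ring.
- move=> g; rewrite -mulrA [nsq _ * nsq g]mulrC; apply: normB_sq_le.
    apply: le_trans (CS _ _) _; rewrite lecR ler_wpM2r ?nsq_ge0//.
  rewrite normrM exprMn -[leRHS]mul1r ler_pM ?exprn_ge0//; last exact: CS.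
  by rewrite exprn_ile1//; exact: ltW (valP z).
by move=> n; rewrite Tm !(@rk_evalE _ _ _ H) !mon exprS subrr.
Qed.

(** Starting from the vector z^k gives the moments from index k on; both k = 0 and k = 1 are
    used. *)
Lemma subnormal_module_dlt_ge0 n (k : nat) : subnormal_module H ->
  0 <= dlt (fun j => (growth (j + k)%:R)^-1) n 0.
Proof.
move=> [T [Tz Tsub]].
have Tm j : T (m j) = m j.+1.
  apply: (monomial_unique (n := j.+1)); last exact: mon.
  by move=> z; rewrite Tz mon exprS.
have itT j : iter j T (m k) = m (j + k)%N by elim: j => //= j ->.
rewrite (eq_dlt _ _ (b := fun j => nsq (iter j T (m k)))); last first.
  by move=> j; rewrite itT (nsq_monomial orth).
apply: (@subnormal_dlt_ge0 _ _ _ _ 1) => // j.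
by rewrite itT (nsq_monomial orth) growthV_le1.
Qed.

Definition moment_kernel (a : nat -> R) (i j : nat * nat) : C :=
  (i.1 + j.2 == j.1 + i.2)%N%:R * toC (a (i.1 + j.2)%N).

(* Vectors indexed by (i, j) with this Gram matrix play the role of
   z^i zbar^j in L^2 of the rotation invariant measure on the disc with radial
   moments 1 / growth. *)
Lemma psd_subnormal_module :
  psd (moment_kernel (fun n => (growth n%:R)^-1)) -> subnormal_module H.
Proof.
move=> Gpsd; set G := moment_kernel _ in Gpsd.
have [T [Tz Tm T1]] := mulz_exists; exists T; split => //.
pose sg (i : nat * nat) := (i.1.+1, i.2).
pose sg' (i : nat * nat) := (i.1, i.2.+1).
have Gbound i j : `|G i j| <= toC 1.
  rewrite /G /moment_kernel normrM normr_nat rmorph1 -[leRHS]mulr1.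
  rewrite ler_pM ?ler0n//; first by case: (_ == _); rewrite ?ler01.
  rewrite ger0_norm ?ler0c ?invr_ge0 ?(ltW (growth_gt0 _ _ _))//.
  by rewrite -(rmorph1 toC) lecR growthV_le1.
have Gadj i j : G (sg i) j = G i (sg' j).
  by rewrite /G /moment_kernel /= addSnnS.
have [phi [N [phiG Nnormal N1 Nphi]]] :=
  normal_op_of_kernel (unit_monomial_orth s1_gt0 s2_gt0 orth)
    (unit_monomial_dense s1_gt0 s2_gt0 mon orth) (0%N, 0%N) Gpsd Gadj
    (fun i => erefl) Gbound.
(* Hence z^i -> phi (i, 0) extends to an isometry [J] of [H] into itself that intertwines [T] with
   [N]. *)
have phi_gram i j : dot (phi (i, 0%N)) (phi (j, 0%N)) = dot (m i) (m j).
  rewrite phiG orth /G /moment_kernel /= !addn0.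
  by case: eqVneq => [->|_]; rewrite ?mul0r// fmorphV.
have le s : nsq (comb (fun i => phi (i, 0%N)) s) <= nsq (comb m s).
  by rewrite -lecR !nsq_comb (eq_kform _ phi_gram).
have [J [Jm J1]] := contraction_extension le m_dense.
exists H, J, N; split=> // [x y|x].
  apply/eqP; rewrite -subr_eq0; apply/eqP.
  apply: (@dense_form_eq0 _ _ _ H H m m
    (fun x y => dot (J x) (J y) - dot x y) 4 m_dense m_dense).
  - by move=> a p q w; rewrite linearP !dotDl !dotZl; ring.
  - by move=> a p q w; rewrite linearP !dotDr !dotZr; ring.
  - move=> p q; apply: normB_sq_le; last exact: CS.
    by apply: le_trans (CS _ _) _; rewrite lecR ler_pM ?nsq_ge0.
  by move=> i j; rewrite !Jm phi_gram subrr.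
apply/eqP; rewrite -subr_eq0; apply/eqP/nsq_eq0; rewrite /nsq.
set w := (X in dot _ X).
suff -> : dot (N (J x) - J (T x)) w = 0 by [].
apply: (@dense_functional_eq0 _ _ _ _ m_dense
  (fun x => dot (N (J x) - J (T x)) w) (4 * nsq w)).
- move=> a p q; rewrite !linearP -dotZl -dotDl; congr (hdot H _ w).
  by rewrite addrACA -scalerDr.
- move=> p; rewrite dotBl -mulrA [nsq w * _]mulrC; apply: normB_sq_le;
    apply: le_trans (CS _ _) _; rewrite lecR ler_wpM2r ?nsq_ge0//.
    exact: le_trans (N1 _) (J1 _).
  exact: le_trans (J1 _) (T1 _).
by move=> n; rewrite Tm !Jm Nphi subrr dot0l.
Qed.

End Module.

(** * Positivity of the moment kernels *)

Section MomentKernels.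
Variable R : realType.
Local Notation C := R[i].
Implicit Types i j : nat * nat.

(** The index condition reads i.1 - i.2 = j.1 - j.2: this is the Gram matrix of the z^i zbar^j on
    the unit circle. *)
Lemma psd_moment_kernel1 : psd (@moment_kernel R (fun=> 1)).
Proof.
apply: eq_psd (@psd_eq R (nat * nat)%type int (fun i => i.1%:Z - i.2%:Z)) => i j.
rewrite /moment_kernel rmorph1 mulr1; congr ((nat_of_bool _)%:R).
by apply/eqP/eqP; lia.
Qed.

Lemma psd_moment_kernelD (a b : nat -> R) :
  psd (moment_kernel a) -> psd (moment_kernel b) ->
  psd (moment_kernel (fun n => a n + b n)).
Proof.
move=> pa pb; apply: eq_psd (psdD pa pb) => i j.
by rewrite /moment_kernel rmorphD mulrDr.
Qed.

Lemma psd_moment_kernelZ (a : nat -> R) (c : R) : 0 <= c ->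
  psd (moment_kernel a) -> psd (moment_kernel (fun n => c * a n)).
Proof.
move=> c0 pa; apply: eq_psd (psdZ c0 pa) => i j.
by rewrite /moment_kernel rmorphM mulrCA.
Qed.

(** On the support of a moment kernel i.1 + j.2 splits into a term in [i] and a term in [j], which
    gives 1/(n + c) the shape of a Cauchy kernel. *)
Definition half_sum i : R := (i.1 + i.2)%:R / 2.

Lemma half_sum_ge0 i : 0 <= half_sum i.
Proof. by rewrite divr_ge0. Qed.

Lemma half_sumD i j : (i.1 + j.2 == j.1 + i.2)%N ->
  half_sum i + half_sum j = (i.1 + j.2)%:R.
Proof.
move=> /eqP e; rewrite /half_sum -mulrDl -natrD.
have -> : (i.1 + i.2 + (j.1 + j.2) = (i.1 + j.2) * 2)%N by lia.
by rewrite natrM mulfK// pnatr_eq0.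
Qed.

Lemma psd_moment_kernel_div (a : nat -> R) (c : R) : 0 < c ->
  psd (moment_kernel a) -> psd (moment_kernel (fun n => a n / (n%:R + c))).
Proof.
move=> c0 pa; pose x i : C := toC (half_sum i + c / 2).
have x0 i : 0 < complex.Re (x i).
  by rewrite /x /= ltr_wpDl ?half_sum_ge0 ?divr_gt0.
apply: eq_psd (psd_cauchy x0 pa) => i j.
rewrite /moment_kernel; have [e|_] := boolP (_ == _)%N; last by rewrite !mul0r.
rewrite !mulr1n !mul1r rmorphM fmorphV /x conj_toC -(rmorphD toC) /=.
by congr (_ / toC _); rewrite -half_sumD//; field.
Qed.

(* 1/s - 1/(s - iy) - 1/(s + iy) + 1/s is the Laplace transform at s of
   |1 - e^(iyu)|^2. *)
Lemma psd_moment_kernel_cos (c y : R) : 0 < c -> y != 0 ->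
  psd (moment_kernel (fun n => ((n%:R + c) * ((n%:R + c) ^+ 2 + y ^+ 2))^-1)).
Proof.
move=> c0 y0.
pose x (t : nat * nat * bool) : C :=
  Complex (half_sum t.1 + c / 2) (if t.2 then y else 0).
have x0 t : 0 < complex.Re (x t).
  by rewrite /x /= ltr_wpDl ?half_sum_ge0 ?divr_gt0.
have p1 := psd_comp (fun t : nat * nat * bool => t.1) psd_moment_kernel1.
have p2 := psd_diff (psd_cauchy x0 p1).
have y2 : 0 <= (2 * y ^+ 2)^-1 by rewrite invr_ge0 mulr_ge0 ?sqr_ge0.
apply: eq_psd (psdZ y2 p2) => i j.
rewrite /moment_kernel /=; have [e|_] := boolP (_ == _)%N; last first.
  by rewrite !mul0r !subr0 addr0 mulr0.
rewrite !mulr1n !mul1r.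
pose s := (i.1 + j.2)%:R + c : R.
have s0 : 0 < s by rewrite /s ltr_wpDl.
have xE b b' : x (i, b) + (x (j, b'))^* =
    Complex s ((if b then y else 0) - (if b' then y else 0)).
  rewrite /x /s -half_sumD//; apply/eqP; rewrite eq_complex /=.
  by apply/andP; split; apply/eqP => //; field.
rewrite !xE !subrr sub0r subr0.
have q0 : s ^+ 2 + y ^+ 2 != 0.
  by rewrite gt_eqF// ltr_pwDl ?sqr_ge0// exprn_gt0.
have s1 := lt0r_neq0 s0.
apply/eqP; rewrite eq_complex /=; apply/andP; split; apply/eqP.
  rewrite !expr0n /= sqrrN -/s; field.
  by rewrite ?s1 ?q0 ?y0.
rewrite !expr0n /= sqrrN; field.
by rewrite ?s1 ?q0 ?y0.
Qed.

Lemma psd_moment_kernel_real (c r1 r2 : R) : 0 <= c -> r1 < 0 -> r2 < 0 ->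
  psd (moment_kernel (fun n => c / ((n%:R + 1) * (n%:R - r1) * (n%:R - r2)))).
Proof.
move=> c0 r10 r20.
have p1 := psd_moment_kernel_div ltr01 psd_moment_kernel1.
have r1' : 0 < - r1 by rewrite oppr_gt0.
have r2' : 0 < - r2 by rewrite oppr_gt0.
have p3 := psd_moment_kernel_div r2' (psd_moment_kernel_div r1' p1).
apply: eq_psd (psd_moment_kernelZ c0 p3) => i j; rewrite /moment_kernel.
by congr (_ * toC _); rewrite mul1r -!invfM.
Qed.

Lemma psd_moment_kernel_complex (c x y : R) : 0 <= c -> x <= -1 -> y != 0 ->
  psd (moment_kernel (fun n => c / ((n%:R + 1) * ((n%:R - x) ^+ 2 + y ^+ 2)))).
Proof.
move=> c0 x1 y0; have x0 : 0 < - x by lra.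
have p := psd_moment_kernel_cos x0 y0.
have x1' : 0 <= - 1 - x by lra.
have p1 := psd_moment_kernelZ x1' (psd_moment_kernel_div ltr01 p).
apply: eq_psd (psd_moment_kernelZ c0 (psd_moment_kernelD p p1)) => i j.
rewrite /moment_kernel; congr (_ * toC _); congr (_ * _).
have n0 := ler0n R (i.1 + j.2)%N; move: ((i.1 + j.2)%:R) n0 => t t0.
have h1 : t - x != 0 by rewrite gt_eqF//; lra.
have h2 : t + 1 != 0 by rewrite gt_eqF//; lra.
have h3 : (t - x) ^+ 2 + y ^+ 2 != 0.
  by rewrite gt_eqF// ltr_pwDl ?sqr_ge0// exprn_gt0//; lra.
by field; rewrite h1 h2 h3.
Qed.

End MomentKernels.

(** * The cubic polynomial *)

Local Transparent growth tail.

Section GrowthPolynomial.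
Variables (R : realType) (s1 s2 : R).
Hypotheses (s1_gt0 : 0 < s1) (s2_gt0 : 0 < s2).
Local Notation C := R[i].
Local Notation growth := (growth s1 s2).

Definition growth_poly : {poly R} :=
  ('X + 1) * ((s1 * s2 / 6) *: ('X * ('X - 1)) + ((s1 + s2) / 2) *: 'X + 1).

Lemma growth_polyE x : growth_poly.[x] = growth x.
Proof. by rewrite /growth_poly /growth -[1]/(1%:P) !hornerE. Qed.

Definition lead_coeff6 : R := s1 * s2 / 6.
Definition lin_coeff : R := 3 * (s1 + s2) / (s1 * s2) - 1.
Definition cst_coeff : R := 6 / (s1 * s2).

Lemma lead_coeff6_gt0 : 0 < lead_coeff6.
Proof. by rewrite divr_gt0// mulr_gt0. Qed.

Lemma cst_coeff_gt0 : 0 < cst_coeff.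
Proof. by rewrite divr_gt0// mulr_gt0. Qed.

Lemma lin_coeff_gt : - 1 < lin_coeff.
Proof.
rewrite /lin_coeff -subr_gt0 opprK subrK divr_gt0//; last by rewrite mulr_gt0.
by rewrite mulr_gt0// addr_gt0.
Qed.

Lemma growth_factor x :
  growth x = lead_coeff6 * ((x + 1) * (x ^+ 2 + lin_coeff * x + cst_coeff)).
Proof.
rewrite /growth /lead_coeff6 /lin_coeff /cst_coeff; field.
by rewrite !gt_eqF.
Qed.

Lemma growth_poly_factor : growth_poly =
  lead_coeff6 *: (('X + 1) * ('X^2 + lin_coeff *: 'X + cst_coeff%:P)).
Proof.
rewrite /growth_poly [RHS]scalerAr mulrBr mulr1 -expr2; congr (_ * _).
apply/polyP => i; rewrite !(coefD, coefZ, coefX, coefC, coefXn, coefN, coef1).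
case: i => [|[|[|i]]] /=; rewrite /lead_coeff6 /lin_coeff /cst_coeff.
- by field; rewrite !gt_eqF.
- by field; rewrite !gt_eqF.
- by field; rewrite !gt_eqF.
- by ring.
Qed.

Lemma size_growth_poly : size growth_poly = 4%N.
Proof.
have sX1 : size ('X + 1 : {poly R}) = 2%N by rewrite -[1]/(1%:P) size_XaddC.
have sq : size ('X^2 + lin_coeff *: 'X + cst_coeff%:P : {poly R}) = 3%N.
  rewrite -addrA size_polyDl size_polyXn//.
  rewrite (leq_ltn_trans (size_polyD _ _))// gtn_max.
  rewrite (leq_ltn_trans (size_scale_leq _ _)) ?size_polyX//.
  by rewrite (leq_ltn_trans (size_polyC_leq1 _)).
rewrite growth_poly_factor size_scale ?gt_eqF ?lead_coeff6_gt0//.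
by rewrite size_mul -?size_poly_eq0 ?sX1 ?sq.
Qed.

Lemma root_growth_poly (z : C) : root (map_poly toC growth_poly) z =
  (z == -1) || (z ^+ 2 + toC lin_coeff * z + toC cst_coeff == 0).
Proof.
rewrite growth_poly_factor linearZ rootZ; last first.
  by rewrite (@fmorph_eq0 _ _ toC) gt_eqF// lead_coeff6_gt0.
rewrite rmorphM rootM !rmorphD /= rmorph1 map_polyX map_polyXn map_polyZ.
rewrite map_polyX map_polyC /=.
rewrite -[1]/(1%:P) /root !hornerE; congr (_ || _).
  by rewrite addr_eq0.
by rewrite /lin_coeff rmorphD.
Qed.

End GrowthPolynomial.

Lemma closure_left_half_plane (R : realType) (r : R) (z : R[i]) :
  closure (left_half_plane r) z <-> complex.Re z <= r.
Proof.
split=> [cz|zr B].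
  rewrite leNgt; apply/negP => rz.
  pose d := complex.Re z - r; have d0 : 0 < d by rewrite subr_gt0.
  have [|w [wr]] := cz (ball (z : R[i]^o) (toC d)).
    by apply: nbhsx_ballx; rewrite ltcR.
  rewrite -ball_normE /= => /(le_lt_trans (normc_ge_Re _)); rewrite ltcR.
  move=> /(le_lt_trans (ler_norm _)); rewrite ReD ReN /d.
  move: wr; rewrite /left_half_plane /=; lra.
rewrite -nbhs_ballE => -[e /= e0 eB].
have eE : e = toC (complex.Re e) by rewrite RRe_real// gtr0_real.
have re : 0 < complex.Re e by move: e0; rewrite {1}eE ltcR.
exists (z - toC (complex.Re e / 2)); split.
  by rewrite /left_half_plane /= ReD ReN /=; lra.
apply: eB; rewrite -ball_normE /= opprB addrC subrK.
rewrite ger0_norm ?ler0c ?divr_ge0 ?(ltW re)// [ltRHS]eE ltcR; lra.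
Qed.

Unset Implicit Arguments.

Theorem theorem1p5 (R : realType) (s1 s2 : R) (hs1 : 0 < s1) (hs2 : 0 < s2)
    (H : module_tensor (bergman_kernel s1) (bergman_kernel s2)) :
  exists p : {poly R},
    size p = 4%N /\
    (forall n : nat, exists f : H,
       is_monomial n f /\ (`|f| ^+ 2)^-1 = real_complex R p.[n%:R]) /\
    let pC : {poly R[i]} := map_poly (real_complex R) p in
    ((forall z : R[i], root pC z -> z \is Num.real) ->
       (subnormal_module H <->
        forall z : R[i], root pC z -> left_half_plane 0 z)) /\
    (forall z0 : R[i], root pC z0 -> z0 \isn't Num.real ->
       (subnormal_module H <-> closure (left_half_plane (-1)) z0)).
Proof.
have [m [mon orth]] := monomials_exist hs1 hs2 H.
exists (growth_poly s1 s2); split; first exact: size_growth_poly.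
split.
  move=> n; exists (m n); split; first exact: mon.
  by rewrite -nsq_norm (nsq_monomial orth) -fmorphV invrK growth_polyE.
set c := (lead_coeff6 s1 s2)^-1.
have c0 : 0 < c by rewrite invr_gt0 lead_coeff6_gt0.
set b := lin_coeff s1 s2; set g := cst_coeff s1 s2.
have b1 : - 1 < b by exact: lin_coeff_gt.
have g0 : 0 < g by exact: cst_coeff_gt0.
have invE (x : R) : (growth s1 s2 x)^-1 = c / ((x + 1) * (x ^+ 2 + b * x + g)).
  by rewrite (growth_factor hs1 hs2) invfM.
have dlt_ge0 n k := @subnormal_module_dlt_ge0 _ _ _ hs1 hs2 H m mon orth n k.
have psd_sub := psd_subnormal_module hs1 hs2 mon orth.
move=> pC; have rootE z : root pC z =
  (z == -1) || (z ^+ 2 + toC b * z + toC g == 0) by exact: root_growth_poly.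
split=> [roots_real|z0 z0root z0real].
  have D0 : 0 <= b ^+ 2 - 4 * g.
    rewrite leNgt; apply/negP => Dneg.
    have y0 : 0 < Num.sqrt (4 * g - b ^+ 2) / 2.
      by rewrite divr_gt0// sqrtr_gt0; lra.
    pose z := Complex (- b / 2) (Num.sqrt (4 * g - b ^+ 2) / 2).
    suff /roots_real : root pC z by rewrite complex_real (gt_eqF y0).
    rewrite rootE; apply/orP; right; rewrite eq_complex /=.
    have sq : Num.sqrt (4 * g - b ^+ 2) ^+ 2 = 4 * g - b ^+ 2.
      by rewrite sqr_sqrtr//; lra.
    move: (Num.sqrt _) sq => y sq.
    by apply/andP; split; apply/eqP; [field: sq|field].
  pose d := Num.sqrt (b ^+ 2 - 4 * g).
  have d0 : 0 <= d by exact: sqrtr_ge0.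
  have d2 : d ^+ 2 = b ^+ 2 - 4 * g by rewrite sqr_sqrtr.
  pose r1 := (- b - d) / 2; pose r2 := (- b + d) / 2.
  have quadE (x : R) : x ^+ 2 + b * x + g = (x - r1) * (x - r2).
    have -> : g = (b ^+ 2 - d ^+ 2) / 4 by rewrite d2; field.
    by rewrite /r1 /r2; field.
  have r12 : r1 <= r2 by rewrite /r1 /r2; lra.
  have r1r2 : r1 * r2 = g.
    have -> : r1 * r2 = (0 - r1) * (0 - r2) by ring.
    by rewrite -quadE; ring.
  have rsum : r1 + r2 = - b by rewrite /r1 /r2; field.
  clearbody r1 r2.
  have rootE' z : root pC z = [|| z == -1, z == toC r1 | z == toC r2].
    rewrite rootE; congr (_ || _).
    rewrite -(subr_eq0 z (toC r1)) -(subr_eq0 z (toC r2)) -mulf_eq0.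
    congr (_ == 0); rewrite -r1r2.
    have -> : b = - (r1 + r2) by rewrite rsum opprK.
    by rewrite rmorphN rmorphD rmorphM; ring.
  have momE n : (growth s1 s2 n%:R)^-1 =
      c / ((n%:R + 1) * (n%:R - r1) * (n%:R - r2)).
    by rewrite invE quadE mulrA.
  have r2E : (forall z : R[i], root pC z -> left_half_plane 0 z) <-> r2 < 0.
    split=> [/(_ (toC r2))|r20 z]; first by rewrite rootE' eqxx !orbT; exact.
    rewrite rootE' => /or3P[] /eqP -> //; rewrite /left_half_plane /=.
    - by rewrite ltrN10.
    - exact: le_lt_trans r12 r20.
  rewrite r2E; split=> [sub|r20].
    rewrite ltNge; apply/negP => r20.
    (* r1 r2 = g > 0 excludes r2 = 0 and makes r1 positive too; then r1 + r2 = -b < 1 gives r2 <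
       1. *)
    have r20' : 0 < r2.
      rewrite lt_def r20 andbT; apply: contraTneq g0 => r2z.
      by rewrite -r1r2 r2z mulr0 ltxx.
    have r10 : 0 < r1 by rewrite -(pmulr_lgt0 _ r20') r1r2.
    have r21 : r2 < 1 by lra.
    apply: (positive_roots_not_cm c0 r10 r12 r21) => n.
    rewrite (eq_dlt _ _ (b := fun j => (growth s1 s2 (j + 0)%:R)^-1)) ?dlt_ge0//.
    by move=> j; rewrite addn0 momE.
  apply: psd_sub.
  apply: eq_psd (psd_moment_kernel_real (ltW c0) (le_lt_trans r12 r20) r20) => i j.
  by rewrite /moment_kernel momE.
rewrite closure_left_half_plane.
move: z0root z0real; rewrite rootE; case: z0 => x y.
rewrite complex_real => root0 y0.
have : Complex x y ^+ 2 + toC b * Complex x y + toC g == 0.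
  case/orP: root0 => // /eqP h; move: y0.
  by rewrite (_ : y = complex.Im (Complex x y))// h /= oppr0 eqxx.
rewrite eq_complex /= => /andP[/eqP hRe /eqP hIm].
have bE : b = - 2 * x.
  have : y * (2 * x + b) = 0 by rewrite -hIm; ring.
  by move=> /eqP; rewrite mulf_eq0 (negPf y0) /= => /eqP; lra.
have gE : g = x ^+ 2 + y ^+ 2.
  by move: hRe; rewrite bE; lra.
have quadE (t : R) : t ^+ 2 + b * t + g = (t - x) ^+ 2 + y ^+ 2.
  by rewrite bE gE; ring.
have x2 : x < 2^-1 by lra.
split=> [sub|x1]; last first.
  apply: psd_sub; apply: eq_psd (psd_moment_kernel_complex (ltW c0) x1 y0) => i j.
  by rewrite /moment_kernel invE quadE.
rewrite leNgt; apply/negP => /= x1.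
have [x0|x0] := ltP x 0.
  apply: (@complex_roots_not_cm R c 1 (Complex (- x) y)) => //=; [lra|lra|] => n.
  rewrite (eq_dlt _ _ (b := fun j => (growth s1 s2 (j + 0)%:R)^-1)) ?dlt_ge0//.
  by move=> j; rewrite addn0 invE quadE.
(* For 0 <= x < 1/2 the moments from index 1 on are used: replacing n by n + 1 turns the factor n +
   1 into n + 2 and -x into 1 - x > 0. *)
apply: (@complex_roots_not_cm R c 2 (Complex (1 - x) y)) => //=; [lra|lra|] => n.
rewrite (eq_dlt _ _ (b := fun j => (growth s1 s2 (j + 1)%:R)^-1)) ?dlt_ge0//.
move=> j; rewrite natrD invE quadE; congr (_ / (_ * (_ ^+ 2 + _))); ring.
Qed.
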